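(* Let $\mu\in\mathcal M^+(\mathbb R)\setminus\{0\}$ with $\|\mu\|_1\le 1$, and let $M\subseteq\mathbb R$ be either finite or equal to $\mathbb R$, with $\operatorname{supp}\mu\subseteq M$. Let $c\in I_M$ satisfy $$c_t(x,t)=H(c,x,t)^2\int_{z\ne x}K'''(c(x,t)-c(z,t))\,d\mu(z),\qquad c(x,0)=x,\qquad (x,t)\in M\times(0,\infty).$$ Define $h(t)=c(\cdot,t)_*\mu$ (push-forward measure) for $t\in\mathbb R^+$ and $\bar h(\cdot,t)=K*h(t)$. Then $(h,\bar h)$ is a weak solution of the Geometric Thin-Film Equation with initial condition $h^0=\mu$, i.e. for every $\phi\in C_c^\infty(\Omega)$, $$\int_{-\infty}^\infty\phi(x,0)\,d\mu(x)+\int_0^\infty\!\!\int_{-\infty}^\infty\bar h\,(1-\alpha^2\partial_{xx})^2\phi_t\,dx\,dt+\int_0^\infty\!\!\int_{-\infty}^\infty\bar h^3\,\partial_{xxx}\bar h\,\phi_x\,dx\,dt$$ $$-2\alpha^2\int_0^\infty\!\!\int_{-\infty}^\infty\bar h^2\,\partial_{xx}\bar h\,\partial_{xxx}\bar h\,\phi_x\,dx\,dt-\alpha^4\int_0^\infty\!\!\int_{-\infty}^\infty\bar h\,\partial_x\bar h\,(\partial_{xxx}\bar h)^2\phi_x\,dx\,dt-\tfrac12\alpha^4\int_0^\infty\!\!\int_{-\infty}^\infty(\bar h\,\partial_{xxx}\bar h)^2\phi_{xx}\,dx\,dt=0.$$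
   Context: $\mathbb R^+=[0,\infty)$ and $\Omega=\mathbb R\times\mathbb R^+$; $C_c^\infty(\Omega)$ is the space of indefinitely differentiable compactly supported functions on $\Omega$ (they need not vanish at $t=0$). $\alpha>0$ is a fixed constant and $K(x)=\frac1{4\alpha^2}(\alpha+|x|)e^{-|x|/\alpha}$, the Green's function of $(1-\alpha^2\partial_{xx})^2$. $K'''$ is the classical third derivative of $K$, defined on $\mathbb R\setminus\{0\}$. $\mathcal M(\mathbb R)$ is the space of finite (signed) Borel measures on $\mathbb R$ with total variation norm $\|\cdot\|_1$, and $\mathcal M^+(\mathbb R)$ its subset of positive measures. The derivatives $\partial_x^k\bar h$ are distributional derivatives in $x$, so that $\partial_x^k\bar h(x,t)=\int K^{(k)}(x-z)\,dh(t)(z)$, $k\le 3$ (almost everywhere in $x$ when $k=3$). $X_M$ is the vector space of locally bounded functions $c:M\times\mathbb R^+\to\mathbb R$ such that $c(\cdot,t)$ is Borel measurable for all $t\in\mathbb R^+$ and $c(x,\cdot)$ is $C^1$ for all $x\in M$. $I_M$ is the set of $c\in X_M$ such that for every $t\in\mathbb R^+$, $c(x,t)<c(y,t)$ whenever $x,y\in M$, $x<y$. Finally $H(c,x,t)=\int_{-\infty}^\infty K(c(x,t)-c(z,t))\,d\mu(z)$. *)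

(* Defs.v *)
From HB Require Import structures.
From mathcomp Require Import all_boot all_order all_algebra.
From mathcomp Require Import all_classical all_reals all_analysis.
Set Implicit Arguments.
Unset Strict Implicit.
Unset Printing Implicit Defensive.
Import Order.TTheory GRing.Theory Num.Theory.
Import numFieldNormedType.Exports.
Local Open Scope classical_set_scope.
Local Open Scope ring_scope.

Notation Rp := `[0, +oo[%classic.

(* One-sided at [t = 0], two-sided at [t > 0]: the values of [f] on the
   negative half-line are never used. *)
Definition quotient_ge0 (R : realType) (f : R -> R) (t s : R) : R :=
  (f s - f t) / (s - t).

Definition derivable_ge0 (R : realType) (f : R -> R) (t : R) : Prop :=
  cvg (quotient_ge0 f t s @[s --> within Rp t^']).

Definition derive_ge0 (R : realType) (f : R -> R) (t : R) : R :=
  lim (quotient_ge0 f t s @[s --> within Rp t^']).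

Definition C1_ge0 (R : realType) (f : R -> R) : Prop :=
  (forall t, 0 <= t -> derivable_ge0 f t) /\
  {within Rp, continuous (derive_ge0 f)}.

(* [Omega = R x [0, +oo[]; functions on [Omega] are represented by curried
   functions on [R x R], whose values at [t < 0] are irrelevant. *)
Definition Omega (R : realType) : set (R * R) := [set: R] `*` Rp.
Arguments Omega : clear implicits.

Definition dx (R : realType) (f : R -> R -> R) : R -> R -> R :=
  fun x t => derive1 (f^~ t) x.

Definition dt (R : realType) (f : R -> R -> R) : R -> R -> R :=
  fun x t => derive_ge0 (f x) t.

Fixpoint Ck_Omega (R : realType) (n : nat) (f : R -> R -> R) : Prop :=
  {within Omega R, continuous (fun p => f p.1 p.2)} /\
  if n is n'.+1 then
    [/\ forall x t, Omega R (x, t) -> derivable (f^~ t) x 1,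
        forall x t, Omega R (x, t) -> derivable_ge0 (f x) t,
        Ck_Omega n' (dx f) & Ck_Omega n' (dt f)]
  else True.

Definition Ccinfty_Omega (R : realType) (f : R -> R -> R) : Prop :=
  (forall n, Ck_Omega n f) /\
  compact (closure [set p | Omega R p /\ f p.1 p.2 != 0]).

Definition Ccinfty (R : realType) (f : R -> R) : Prop :=
  (forall n x, derivable (derive1n n f) x 1) /\
  compact (closure [set x | f x != 0]).

Definition distr_derive (R : realType) (k : nat) (f g : R -> R) : Prop :=
  [/\ locally_integrable setT f, locally_integrable setT g &
      forall psi : R -> R, Ccinfty psi ->
        \int[lebesgue_measure]_x (f x * derive1n k psi x) =
        (-1) ^+ k * \int[lebesgue_measure]_x (g x * psi x)].

Definition msupp (R : realType) (mu : set (measurableTypeR R) -> \bar R) :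
    set R :=
  [set x | forall U : set R, open U -> U x -> (0 < mu U)%E].

(* [nu] is the push-forward of [mu] by [f : M -> R]; only the values of [f] on
   [M] are used, and [mu] is carried by [M] in the application. *)
Definition is_pushforward (R : realType)
    (mu nu : set (measurableTypeR R) -> \bar R) (M : set R) (f : R -> R) :
    Prop :=
  forall A : set (measurableTypeR R), measurable A ->
    nu A = mu (f @^-1` A `&` M).

Section thin_film.
Context (R : realType) (alpha : R).
Implicit Types (mu nu : {finite_measure set (measurableTypeR R) -> \bar R})
  (M : set R) (c phi : R -> R -> R).

Definition K (x : R) : R :=
  (4 * alpha ^+ 2)^-1 * (alpha + `|x|) * expR (- `|x| / alpha).

Definition Kconv nu (x : R) : R := \int[nu]_z K (x - z).

(* A function on [M x [0, +oo[] is represented by [c : R -> R -> R], of which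
   only the values [c x t] with [x \in M] and [0 <= t] are used. *)
Definition XM M c : Prop :=
  [/\ [locally [bounded c p.1 p.2 | p in M `*` Rp]],
      forall t, 0 <= t -> measurable_fun (M : set (measurableTypeR R)) (c^~ t) &
      forall x, M x -> C1_ge0 (c x)].

Definition IM M c : Prop :=
  XM M c /\
  forall t, 0 <= t -> forall x y, M x -> M y -> x < y -> c x t < c y t.

(* Since [msupp mu `<=` M], integrating over [M] is integrating over [R]. *)
Definition H mu M c (x t : R) : R := \int[mu]_(z in M) K (c x t - c z t).

(* The library derivative [derive1n 3 K] is the classical K''' away from [0];
   for [c] strictly increasing on [M] the argument below is never [0]. *)
Definition velocity mu M c (x t : R) : R :=
  H mu M c x t ^+ 2 * \int[mu]_(z in M `\ x) derive1n 3 K (c x t - c z t).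

(* (1 - alpha^2 d_xx)^2 = 1 - 2 alpha^2 d_xx + alpha^4 d_xxxx *)
Definition helmholtz (f : R -> R -> R) : R -> R -> R :=
  fun x t => f x t - alpha ^+ 2 * dx (dx f) x t.

Local Notation leb := (@lebesgue_measure R).

(* [u1], [u2], [u3] stand for the distributional derivatives of [u] in [x],
   which are unique up to null sets, so that none of the integrals depends on
   the representatives. *)
Definition weak_solution mu0
    (h : R -> {finite_measure set (measurableTypeR R) -> \bar R}) : Prop :=
  let u x t := Kconv (h t) x in
  exists u1 u2 u3 : R -> R -> R,
  (forall t, 0 <= t ->
    [/\ distr_derive 1 (u^~ t) (u1^~ t), distr_derive 2 (u^~ t) (u2^~ t) &
        distr_derive 3 (u^~ t) (u3^~ t)]) /\
  forall phi, Ccinfty_Omega phi ->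
    \int[mu0]_x phi x 0
    + \int[leb]_(t in Rp) \int[leb]_x
        (u x t * helmholtz (helmholtz (dt phi)) x t)
    + \int[leb]_(t in Rp) \int[leb]_x (u x t ^+ 3 * u3 x t * dx phi x t)
    - 2 * alpha ^+ 2 * \int[leb]_(t in Rp) \int[leb]_x
        (u x t ^+ 2 * u2 x t * u3 x t * dx phi x t)
    - alpha ^+ 4 * \int[leb]_(t in Rp) \int[leb]_x
        (u x t * u1 x t * u3 x t ^+ 2 * dx phi x t)
    - 2^-1 * alpha ^+ 4 * \int[leb]_(t in Rp) \int[leb]_x
        ((u x t * u3 x t) ^+ 2 * dx (dx phi) x t) = 0.

End thin_film.

(* Main.v *)
(* For each time [t], [u = K * h] is C^2 in [x] and its third derivative has a
   jump [m / alpha^4] at every atom of mass [m] of [h]. Away from the origin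
   [alpha^4 K'''' = - (K - 2 alpha^2 K'')], so that
   [g (K - 2 alpha^2 K'')(x - y) K'''(x - y')], symmetrized in [y, y'], minus
   [alpha^4 g' K'''(x - y) K'''(x - y')] is a total derivative in [x] whose
   integral is the sum of the jumps [g(y) K'''(y - y') + g(y') K'''(y' - y)].
   Integrating this in [y, y'] against [h], with [g = phi_x u^2], gives
   [int phi_x u^2 (avg u''') dh] as the sum of the nonlinear terms of the weak
   formulation, where [avg u'''] is the mean of the one-sided limits, that is
   the integral over [z <> x] of the ODE. By the ODE, these terms together with
   the Green identity [int u (1 - alpha^2 d_xx)^2 phi_t dx = int phi_t dh] make up
   the time derivative of [int phi(c(z, t), t) dmu(z)]; the fundamental theorem
   of calculus in [t] concludes. *)
Require Import Defs.
From HB Require Import structures.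
From mathcomp Require Import all_boot all_order all_algebra.
From mathcomp Require Import all_classical all_reals all_analysis.
From mathcomp Require Import measurable_realfun ring lra zify.
Set Implicit Arguments.
Unset Strict Implicit.
Unset Printing Implicit Defensive.
Import Order.TTheory GRing.Theory Num.Theory.
Import numFieldNormedType.Exports.
Local Open Scope classical_set_scope.
Local Open Scope ring_scope.

(** * Dominated convergence and Fubini for real-valued integrals *)

Section integration.
Context {R : realType}.

(** The obstacle is that [h t] may keep atoms at all times: u''' jumps there, while the ODE omits
    the label z = x. One convention settles both: [Kn 3] takes at 0 the mean of its one-sided
    values, which is 0. Then [potential 3] is avg u''' at every point, omitting a label costs
    nothing, and all integrals run over the whole line. The jump formula persists for y = y',
    because K''' has opposite one-sided values at 0 and its square does not jump.

    The nonlinear terms are only shown to be continuous in t, which is what the fundamental theorem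
    asks of an integrand. At fixed x a coefficient may jump when an atom passes, but for a fixed t0
    the offending x are the atoms of [h t0], a Lebesgue-null set, so dominated convergence gives
    continuity of the integrals in x.

    To have two-sided limits and full integrals, c is extended by 0 off M and times are clamped to
    [Num.max t 0]. The pairing of phi with h is differentiated only at t > 0, where the ODE holds;
    continuity carries the identity to t = 0. *)

Lemma integrable_dominated d (T : measurableType d)
    (m : {measure set T -> \bar R}) (f w : T -> R) :
  measurable_fun setT f -> m.-integrable setT (EFin \o w) ->
  (forall x, `|f x| <= w x) -> m.-integrable setT (EFin \o f).
Proof.
move=> mf iw fw; apply: le_integrable iw => //; first exact/measurable_EFinP.
move=> x _ /=; rewrite lee_fin (le_trans (fw x))// ler_norm//.
Qed.

Lemma integrable_EFinD d (T : measurableType d)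
    (m : {measure set T -> \bar R}) (f g : T -> R) :
  m.-integrable setT (EFin \o f) -> m.-integrable setT (EFin \o g) ->
  m.-integrable setT (EFin \o (fun x => f x + g x)).
Proof. by move=> mf mg; exact: (integrableD measurableT mf mg). Qed.

Lemma integrable_EFinZ d (T : measurableType d)
    (m : {measure set T -> \bar R}) (k : R) (f : T -> R) :
  m.-integrable setT (EFin \o f) ->
  m.-integrable setT (EFin \o (fun x => k * f x)).
Proof. by move=> mf; exact: (integrableZl measurableT k mf). Qed.

Lemma integrable_bounded d (T : measurableType d)
    (m : {finite_measure set T -> \bar R}) (f : T -> R) (C : R) :
  measurable_fun setT f -> (forall x, `|f x| <= C) ->
  m.-integrable setT (EFin \o f).
Proof.
move=> mf fC; apply: (@integrable_dominated _ _ _ f (cst C)) => //.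
exact: finite_measure_integrable_cst.
Qed.

Lemma le_norm_Rintegral d (T : measurableType d)
    (m : {finite_measure set T -> \bar R}) (f : T -> R) (C : R) :
  measurable_fun setT f -> (forall x, `|f x| <= C) ->
  `|\int[m]_x f x| <= C * fine (m setT).
Proof.
move=> mf fC; have intf := integrable_bounded m mf fC.
rewrite (le_trans (le_normr_Rintegral _ intf))//.
rewrite -Rintegral_cst//; apply: le_Rintegral => //.
- by apply: integrable_norm intf.
- exact: finite_measure_integrable_cst.
Qed.

(** Continuity of the integrand is asked at the single parameter [a], outside a null set that may
    depend on [a]: this suits integrands whose jumps move with the parameter. *)
Lemma continuous_at_Rintegral d (T : measurableType d)
    (m : {measure set T -> \bar R}) (f : R -> T -> R) (w : T -> R) (a : R) :
  (forall t, measurable_fun setT (f t)) -> m.-integrable setT (EFin \o w) ->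
  (forall t x, `|f t x| <= w x) ->
  {ae m, forall x, {for a, continuous (f^~ x)}} ->
  {for a, continuous (fun t => \int[m]_x f t x)}.
Proof.
move=> mf iw fw cf; apply/(@cvg_nbhsP _ R^o) => v va.
have intf t : m.-integrable setT (EFin \o f t).
  exact: integrable_dominated iw (fw t).
have [] := @dominated_convergence _ _ _ m _ measurableT
  (fun n x => (f (v n) x)%:E) (fun x => (f a x)%:E) (EFin \o w).
- by move=> n; exact/measurable_EFinP.
- exact/measurable_EFinP.
- apply: filterS cf => x cfx _; apply: cvg_EFin; first exact: nearW.
  by move/(@cvg_nbhsP _ R^o) : cfx; apply.
- exact: iw.
- by apply: aeW => x n _; rewrite lee_fin.
- move=> _ _ cvgI; rewrite /Rintegral; apply: fine_cvg.
  by rewrite fineK//; exact: (integrable_fin_num measurableT (intf a)).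
Qed.

Section fubini.
Context d1 d2 (T1 : measurableType d1) (T2 : measurableType d2).
Variables (m1 : {sigma_finite_measure set T1 -> \bar R})
  (m2 : {finite_measure set T2 -> \bar R}).
Variables (f : T1 * T2 -> R) (w : T1 -> R).
Hypothesis mf : measurable_fun setT f.
Hypothesis iw : m1.-integrable setT (EFin \o w).
Hypothesis fw : forall x y, `|f (x, y)| <= w x.

(** Since [w] depends on the first variable only and [m2] is finite, the iterated integral is at
    most [m2 setT] times that of [|w|]; [m1] can thus be Lebesgue measure. *)
Lemma integrable_prod_dominated : (m1 \x m2)%E.-integrable setT (EFin \o f).
Proof.
apply/integrable12ltyP; first exact/measurable_EFinP.
apply: (@le_lt_trans _ _ (\int[m1]_x (`|w x|%:E * m2 setT))%E).
  apply: ge0_le_integral => //.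
  - by move=> x _; apply: integral_ge0.
  - apply: (measurable_fun_fubini_tonelli_F (abse \o (EFin \o f))) => //=.
    by apply: measurableT_comp => //; exact/measurable_EFinP.
  - apply: emeasurable_funM => //; apply/measurable_EFinP.
    by apply: measurableT_comp => //; case/integrableP : iw => /measurable_EFinP.
  - move=> x _; rewrite -integral_cst//; apply: ge0_le_integral => //.
    + apply: measurableT_comp => //; apply/measurable_EFinP.
      by apply: measurableT_comp => //; exact: measurable_pair1.
    + by move=> y _ /=; rewrite lee_fin (le_trans (fw x y))// ler_norm.
have m2fin : m2 setT \is a fin_num by exact: fin_num_measure.
rewrite -(fineK m2fin); under eq_integral do rewrite muleC.
rewrite ge0_integralZl//; last 2 first.
- apply/measurable_EFinP; apply: measurableT_comp => //.
  by case/integrableP : iw => /measurable_EFinP.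
- by rewrite lee_fin fine_ge0.
by apply: lte_mul_pinfty => //; [rewrite lee_fin fine_ge0|case/integrableP : iw].
Qed.

Lemma integrable_section1 x : m2.-integrable setT (EFin \o (fun y => f (x, y))).
Proof.
apply: (@integrable_bounded _ _ m2 _ (w x)) => //.
by apply: measurableT_comp => //; exact: measurable_pair1.
Qed.

Lemma integrable_section2 y : m1.-integrable setT (EFin \o (fun x => f (x, y))).
Proof.
apply: (@integrable_dominated _ _ m1 _ w) => //.
by apply: measurableT_comp => //; exact: measurable_pair2.
Qed.

Let integral1E x : (\int[m2]_y (EFin \o f) (x, y))%E = (\int[m2]_y f (x, y))%:E.
Proof. by rewrite /Rintegral fineK//; exact/integrable_fin_num/integrable_section1. Qed.

Let integral2E y : (\int[m1]_x (EFin \o f) (x, y))%E = (\int[m1]_x f (x, y))%:E.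
Proof. by rewrite /Rintegral fineK//; exact/integrable_fin_num/integrable_section2. Qed.

Lemma Rfubini :
  \int[m1]_x \int[m2]_y f (x, y) = \int[m2]_y \int[m1]_x f (x, y).
Proof.
have := integrable_prod_dominated => /Fubini.
rewrite (eq_integral (fun x => (\int[m2]_y f (x, y))%:E)); last by move=> x _; exact: integral1E.
rewrite [in RHS](eq_integral (fun y => (\int[m1]_x f (x, y))%:E)); last by move=> y _; exact: integral2E.
by rewrite {1}/Rintegral {2}/Rintegral => ->.
Qed.

End fubini.

Lemma measurable_fun_Rintegral d1 d2 (T1 : measurableType d1)
    (T2 : measurableType d2) (m2 : {finite_measure set T2 -> \bar R})
    (f : T1 * T2 -> R) (C : R) :
  measurable_fun setT f -> (forall z, `|f z| <= C) ->
  measurable_fun setT (fun x => \int[m2]_y f (x, y)).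
Proof.
move=> mf fC.
have mfx x : measurable_fun setT (fun y => f (x, y)).
  by apply: measurableT_comp => //; exact: measurable_pair1.
have ifx x : m2.-integrable setT (EFin \o (fun y => f (x, y))).
  exact: (@integrable_bounded _ _ m2 _ C).
(* Adding [C] makes the integrand nonnegative, the setting of Tonelli's measurability; the constant
   is subtracted afterwards, [m2] being finite. *)
rewrite (_ : (fun x => _) = (fun x =>
    fine (\int[m2]_y (f (x, y) + C)%:E) - C * fine (m2 setT))); last first.
  apply/funext => x; rewrite -/(Rintegral _ _ _) RintegralD//; last first.
    exact: finite_measure_integrable_cst.
  by rewrite Rintegral_cst// addrK.
apply: measurable_funB => //; apply: measurableT_comp => //.
apply: (measurable_fun_fubini_tonelli_F (fun z => (f z + C)%:E)) => /=.
- by apply/measurable_EFinP; apply: measurable_funD.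
- by move=> z; rewrite lee_fin; have := fC z; rewrite ler_norml => /andP[]; lra.
Qed.

End integration.

(** * Lebesgue measure on the line: null sets of atoms, piecewise primitives *)

Section lebesgue.
Context {R : realType}.
Local Notation leb := (@lebesgue_measure R).

(** Tonelli on the diagonal: the integral of [nu [set x]] in x equals the integral of [leb [set y]],
    which is 0, against [nu]. *)
Lemma ae_measure_set1_eq0
    (nu : {finite_measure set (measurableTypeR R) -> \bar R}) :
  {ae leb, forall x : R, nu [set x] = 0%E}.
Proof.
pose D : set (measurableTypeR R * measurableTypeR R) :=
  (fun z => z.1 - z.2) @^-1` [set 0].
have mD : measurable D.
  rewrite /D -[X in measurable X]setTI.
  have mf : measurable_fun setT
    (fun z : measurableTypeR R * measurableTypeR R => (z.1 - z.2 : measurableTypeR R)).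
    exact: measurable_funB.
  by apply: mf => //; exact: measurable_set1.
have set1E (m : {measure set (measurableTypeR R) -> \bar R}) (x : R) :
    (\int[m]_y (\1_[set x] y)%:E)%E = m [set x].
  by rewrite integral_indic// setIT.
have DE x y : \1_D (x, y) = \1_[set x] y :> R.
  rewrite !indicE /D; congr (_%:R); congr nat_of_bool.
  apply/idP/idP; rewrite !inE /=; last by move=> ->; rewrite subrr.
  by move/eqP; rewrite subr_eq0 => /eqP.
have nuE x : (\int[nu]_y (\1_D (x, y))%:E)%E = nu [set x].
  by rewrite -set1E; apply: eq_integral => y _; rewrite DE.
have I0 : (\int[leb]_x nu [set x] = 0)%E.
  have := @fubini_tonelli _ _ (measurableTypeR R) (measurableTypeR R) R leb nu
    (fun z => (\1_D z)%:E).
  under eq_integral do rewrite nuE.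
  move=> ->; last 2 first.
  - by apply/measurable_EFinP; exact: measurable_indic.
  - by move=> z; rewrite lee_fin.
  apply: integral0_eq => y _.
  rewrite -[RHS](@lebesgue_measure_set1 R y) -set1E.
  apply: eq_integral => x _; rewrite DE !indicE; congr (_%:R%:E).
  by congr nat_of_bool; apply/idP/idP; rewrite !inE => ->.
have mnu : measurable_fun setT (fun x : R => nu [set x]).
  under eq_fun do rewrite -nuE.
  apply: (measurable_fun_fubini_tonelli_F (fun z => (\1_D z)%:E)) => //.
  by apply/measurable_EFinP; exact: measurable_indic.
have /(ae_eq_integral_abs leb measurableT mnu) : (\int[leb]_x `|nu [set x]| = 0)%E.
  by under eq_integral do rewrite gee0_abs//.
by apply: filterS => x /= ->.
Qed.

Lemma Rintegral_itvoo_FTC (a b : R) (F f : R -> R) : a <= b ->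
  (forall x : R, is_derive x 1 F (f x)) -> continuous f ->
  leb.-integrable `]a, b[ (EFin \o f) /\
  \int[leb]_(x in `]a, b[) f x = F b - F a.
Proof.
move=> ab dF cf.
have intf : leb.-integrable `[a, b] (EFin \o f).
  apply: continuous_compact_integrable; first exact: segment_compact.
  exact: continuous_subspaceT.
have intf' : leb.-integrable `]a, b[ (EFin \o f).
  by apply: integrableS intf => //; apply: subset_itv; rewrite bnd_simp.
split=> //.
move: ab; rewrite le_eqVlt => /predU1P[->|ab].
  by rewrite set_itv_ge ?bnd_simp ?ltxx// Rintegral_set0 subrr.
rewrite Rintegral_itv_bndo_bndc// Rintegral_itv_obnd_cbnd; last first.
  by apply: integrableS intf => //; apply: subset_itv; rewrite bnd_simp.
have cF : continuous F.
  by move=> x; apply/differentiable_continuous/derivable1_diffP; apply: ex_derive.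
rewrite /Rintegral (@continuous_FTC2 _ f F)//.
- exact: continuous_subspaceT.
- split.
  + by move=> x _; apply: ex_derive.
  + by apply: cvg_at_right_filter; exact: cF.
  + by apply: cvg_at_left_filter; exact: cF.
- by move=> x _; rewrite derive1E; apply: derive_val.
Qed.

(** The integral is the sum of the jumps of a primitive. Each piece extends continuously to the
    whole line with a global primitive [Fi], whose value at a break is a one-sided limit. The values
    of [f] at the breaks are irrelevant, and [a = b] is allowed. *)
Lemma Rintegral_two_breaks (a b B : R) (f F1 f1 F2 f2 F3 f3 : R -> R) : a <= b ->
  (forall x : R, is_derive x 1 F1 (f1 x)) -> continuous f1 ->
  (forall x : R, is_derive x 1 F2 (f2 x)) -> continuous f2 ->
  (forall x : R, is_derive x 1 F3 (f3 x)) -> continuous f3 ->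
  (forall x, x < a -> f x = f1 x) ->
  (forall x, a < x < b -> f x = f2 x) ->
  (forall x, b < x -> f x = f3 x) ->
  measurable_fun setT f ->
  (forall x, B < `|x| -> f x = 0 /\ F1 x = 0 /\ F3 x = 0) ->
  \int[leb]_x f x = F1 a - F2 a + F2 b - F3 b.
Proof.
move=> ab dF1 cf1 dF2 cf2 dF3 cf3 ff1 ff2 ff3 mf f0.
(* [L] encloses both breaks and exceeds [B], so [F1 (- L)] and [F3 L] vanish. *)
pose L : R := `|a| + `|b| + `|B| + 1.
have [La bL] : - L <= a /\ b <= L.
  have := ler_norm (- a); have := ler_norm b; have := normr_ge0 a.
  have := normr_ge0 b; have := normr_ge0 B; rewrite normrN /L; lra.
have BL : B < `|L| /\ B < `|- L|.
  rewrite normrN; have := ler_norm L; have := ler_norm B.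
  by have := normr_ge0 a; have := normr_ge0 b; rewrite /L; lra.
have [i1 I1] := Rintegral_itvoo_FTC La dF1 cf1.
have [i2 I2] := Rintegral_itvoo_FTC ab dF2 cf2.
have [i3 I3] := Rintegral_itvoo_FTC bL dF3 cf3.
have {}I1 : \int[leb]_(x in `](- L), a[) f1 x = F1 a.
  by rewrite I1; have [_ [-> _]] := f0 _ BL.2; rewrite subr0.
have {}I3 : \int[leb]_(x in `]b, L[) f3 x = - F3 b.
  by rewrite I3; have [_ [_ ->]] := f0 _ BL.1; rewrite sub0r.
have patch (g : R -> R) u v : leb.-integrable `]u, v[ (EFin \o g) ->
    leb.-integrable setT (EFin \o (g \_ `]u, v[)).
  move=> ig; rewrite -restrict_EFin.
  by apply/(integrable_mkcond _ _).1.
have pin (h : R -> R) u v y : u < y < v -> (h \_ `]u, v[) y = h y.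
  by move=> uyv; rewrite patchE mem_setE in_itv/= uyv.
have pout (h : R -> R) u v y : y <= u \/ v <= y -> (h \_ `]u, v[) y = 0.
  by move=> uyv; rewrite patchE mem_setE in_itv/=; case: ifPn => // /andP[]; lra.
have L0 : 0 <= L by rewrite /L !addr_ge0.
pose g : R -> R := (fun x => (f1 \_ `](- L), a[) x + (f2 \_ `]a, b[) x + (f3 \_ `]b, L[) x).
have {patch}[j1 j2 j3] := And3 (patch _ _ _ i1) (patch _ _ _ i2) (patch _ _ _ i3).
have -> : \int[leb]_x f x = \int[leb]_x g x.
  rewrite /Rintegral; congr fine; apply: ae_eq_integral => //.
  - exact/measurable_EFinP.
  - apply/measurable_EFinP/measurable_funD; first apply: measurable_funD.
    + by case/integrableP : j1 => /measurable_EFinP.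
    + by case/integrableP : j2 => /measurable_EFinP.
    + by case/integrableP : j3 => /measurable_EFinP.
  (* Nothing is known of [f] at the breaks, and the patched pieces are 0 at the ends of their open
     intervals: these four points are discarded. *)
  - exists ([set a] `|` [set b] `|` [set L] `|` [set - L]).
    have m1 (x : R) : measurable [set x : measurableTypeR R] by exact: measurable_set1.
    split.
    + by apply: measurableU => //; apply: measurableU => //; apply: measurableU.
    + rewrite !null_set_setU//; try exact: lebesgue_measure_set1;
      do ?[apply: measurableU => //].
    + move=> x /=; rewrite not_implyE => -[_ fg].
      apply: contrapT => /not_orP [/not_orP [/not_orP [/eqP xa /eqP xb] /eqP xL] /eqP xNL].
      apply: fg; congr _%:E; rewrite /g.
      have [xa'|ax] : x < a \/ a < x by case: ltgtP xa => // *; [left|right].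
      * rewrite (pout f2); last by left; apply: ltW.
        rewrite (pout f3) ?addr0; last by left; lra.
        have [xL'|Lx] : x < - L \/ - L < x by case: ltgtP xNL => // *; [left|right].
          rewrite pout; last by left; apply: ltW.
          apply: (f0 _ _).1; rewrite (lt_le_trans BL.2)// !ler0_norm; lra.
        by rewrite pin ?Lx ?ff1.
      * rewrite (pout f1) ?add0r; last by right; apply: ltW.
        have [xb'|bx] : x < b \/ b < x by case: ltgtP xb => // *; [left|right].
          rewrite (pout f3) ?addr0; last by left; lra.
          by rewrite pin ?ff2 ?ax.
        rewrite (pout f2) ?add0r; last by right; lra.
        have [xL'|Lx] : x < L \/ L < x by case: ltgtP xL => // *; [left|right].
          by rewrite pin ?bx ?ff3.
        rewrite pout; last by right; apply: ltW.
        apply: (f0 _ _).1; rewrite (lt_le_trans BL.1)// !ger0_norm; lra.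
rewrite /g RintegralD//; last exact: integrable_EFinD.
by rewrite RintegralD// -!Rintegral_mkcond I1 I2 I3; ring.
Qed.
End lebesgue.

(** * The kernel and its derivatives *)

Section pointwise_derivatives.
Context {R : realType}.
Implicit Types (f g : R -> R) (x df dg k : R).

Lemma is_derive1P f x df :
  is_derive x 1 f df <-> (f (k + x) - f x) / k @[k --> 0^'] --> df.
Proof.
have E : (fun k : R => k^-1 *: ((f \o shift x) (k *: (1 : R)) - f x)) =
    (fun k => (f (k + x) - f x) / k).
  by apply/funext => k; rewrite /= /GRing.scale/= mulr1 mulrC.
split=> [[]|dF].
  by rewrite /derivable /derive E => + <-.
by split; rewrite ?/derivable ?/derive E; [exact: cvgP dF|exact: cvg_lim dF].
Qed.

Lemma is_derive1_eq f x df df' :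
  is_derive x 1 f df -> df = df' -> is_derive x 1 f df'.
Proof. by move=> ? <-. Qed.

Lemma is_derive1_cst k x : is_derive x 1 (fun _ : R => k) (0 : R).
Proof. exact: is_derive_cst. Qed.

Lemma is_derive1_id x : is_derive x 1 (fun y : R => y) (1 : R).
Proof. exact: is_derive_id. Qed.

Lemma is_derive1D f g x df dg : is_derive x 1 f df -> is_derive x 1 g dg ->
  is_derive x 1 (fun y => f y + g y) (df + dg).
Proof. by move=> *; exact: is_deriveD. Qed.

Lemma is_derive1B f g x df dg : is_derive x 1 f df -> is_derive x 1 g dg ->
  is_derive x 1 (fun y => f y - g y) (df - dg).
Proof. by move=> *; exact: is_deriveB. Qed.

Lemma is_derive1N f x df : is_derive x 1 f df ->
  is_derive x 1 (fun y => - f y) (- df).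
Proof. by move=> *; exact: is_deriveN. Qed.

Lemma is_derive1M f g x df dg : is_derive x 1 f df -> is_derive x 1 g dg ->
  is_derive x 1 (fun y => f y * g y) (f x * dg + g x * df).
Proof. by move=> *; exact: is_deriveM. Qed.

Lemma is_derive1_shift f x y df : is_derive (x - y) 1 f df ->
  is_derive x 1 (fun z => f (z - y)) df.
Proof.
move=> dF; rewrite -[df]mulr1.
apply: (@is_derive1_comp _ f (fun z => z - y)).
have := is_derive1B (is_derive1_id x) (is_derive1_cst y x).
by rewrite subr0.
Qed.

Lemma is_derive1_continuous f x df : is_derive x 1 f df ->
  {for x, continuous f}.
Proof.
by move=> dF; apply/differentiable_continuous/derivable1_diffP; apply: ex_derive.
Qed.

Lemma is_derive1E f x df : is_derive x 1 f df -> derive1 f x = df.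
Proof. by move=> dF; rewrite derive1E; apply: derive_val. Qed.

Lemma derivable_is_derive1 f x : derivable f x 1 -> is_derive x 1 f (derive1 f x).
Proof. by move=> dF; apply: DeriveDef => //; rewrite derive1E. Qed.

Lemma is_derive1_glue f g h x df :
  is_derive x 1 f df -> is_derive x 1 g df ->
  (forall y, y <= x -> h y = f y) -> (forall y, x <= y -> h y = g y) ->
  is_derive x 1 h df.
Proof.
move=> /is_derive1P dF /is_derive1P dG hf hg; apply/is_derive1P.
apply/cvgrPdist_lt => e e0.
move/cvgrPdist_lt : dF => /(_ e e0) dF; move/cvgrPdist_lt : dG => /(_ e e0) dG.
near=> k; have [k0|k0] := leP k 0.
  rewrite hf; last by rewrite -lerBrDr subrr.
  by rewrite hf//; near: k.
rewrite hg; last by rewrite -lerBlDr subrr ltW.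
by rewrite hg//; near: k.
Unshelve. all: by end_near. Qed.

End pointwise_derivatives.

(* [notypeclasses] keeps the library instances of [is_derive] from interfering. *)
Ltac derive1_rec :=
  first [ eassumption
        | notypeclasses refine (is_derive1_cst _ _) | simple notypeclasses refine (is_derive1_id _)
        | notypeclasses refine (is_derive1D _ _); derive1_rec
        | notypeclasses refine (is_derive1B _ _); derive1_rec
        | notypeclasses refine (is_derive1N _); derive1_rec
        | notypeclasses refine (is_derive1M _ _); derive1_rec
        | idtac ].
Ltac derive1_auto := notypeclasses refine (is_derive1_eq _ _); [derive1_rec|cbv beta].

Section kernel.
Context {R : realType} (alpha : R).
Hypothesis alpha_gt0 : 0 < alpha.
Local Notation K := (K alpha).

(* [kbranch n s] is the smooth extension to all reals of the [n]-th derivative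
   of [K] on the half-line of sign [s]; taking [s = Num.sg x] at [x = 0] gives
   the average of the two one-sided values. *)
Definition kbranch (n : nat) (s x : R) : R :=
  match n with
  | 0 => (4 * alpha ^+ 2)^-1 * (alpha + s * x)
  | 1 => - (4 * alpha ^+ 3)^-1 * x
  | 2 => - (4 * alpha ^+ 3)^-1 * (1 - s * x / alpha)
  | 3 => (4 * alpha ^+ 4)^-1 * (2 * s - x / alpha)
  | _ => (4 * alpha ^+ 5)^-1 * (- 3 + s * x / alpha)
  end * expR (- (s * x) / alpha).

(* Locked so that rewriting with ring lemmas does not unfold it to a product. *)
Definition Kn (n : nat) (x : R) : R := locked (kbranch n (Num.sg x) x).

Lemma KnE n x : Kn n x = kbranch n (Num.sg x) x.
Proof. by rewrite /Kn -lock. Qed.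

Let alpha_neq0 : alpha != 0. Proof. by rewrite gt_eqF. Qed.

Lemma kbranch_ode s x :
  kbranch 4 s x = - (kbranch 0 s x - 2 * alpha ^+ 2 * kbranch 2 s x) / alpha ^+ 4.
Proof. by rewrite /kbranch; field; exact: alpha_neq0. Qed.

(** Differentiating the exponential produces squares of the sign, which the formulas of [kbranch]
    have already replaced by 1. *)
Lemma is_derive_kbranch n s (x : R) : (n < 4)%N -> s ^+ 2 = 1 ->
  is_derive x 1 (kbranch n s) (kbranch n.+1 s x).
Proof.
move=> n4 s1.
have dE : is_derive x 1 (fun x => expR (- (s * x) / alpha))
    (expR (- (s * x) / alpha) * - (s / alpha)).
  apply: (is_derive1_comp (f := expR) (g := fun x => - (s * x) / alpha)).
  by derive1_auto; field.
case: n n4 => [|[|[|[|//]]]] _; rewrite /kbranch;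
  derive1_auto; field: s1; exact: alpha_neq0.
Qed.

Lemma continuous_kbranch n s : (n < 4)%N -> s ^+ 2 = 1 -> continuous (kbranch n s).
Proof.
by move=> n4 s1 x; exact: is_derive1_continuous (is_derive_kbranch x n4 s1).
Qed.

Lemma Kn_pos n x : 0 < x -> Kn n x = kbranch n 1 x.
Proof. by move=> x0; rewrite KnE gtr0_sg. Qed.

Lemma Kn_neg n x : x < 0 -> Kn n x = kbranch n (-1) x.
Proof. by move=> x0; rewrite KnE ltr0_sg. Qed.

(** At 0 the sign first shows up in the third derivative: K is of class C^2, and boundary terms of
    order below three cancel. *)
Lemma kbranch0 n s s' : (n < 3)%N -> kbranch n s 0 = kbranch n s' 0.
Proof. by case: n => [|[|[|//]]] _; rewrite /kbranch !mulr0 ?mul0r. Qed.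

Lemma Kn_ge0 n x : (n < 3)%N -> 0 <= x -> Kn n x = kbranch n 1 x.
Proof.
move=> n3; rewrite le_eqVlt => /predU1P[<-|]; last exact: Kn_pos.
by rewrite KnE; exact: kbranch0.
Qed.

Lemma Kn_le0 n x : (n < 3)%N -> x <= 0 -> Kn n x = kbranch n (-1) x.
Proof.
move=> n3; rewrite le_eqVlt => /predU1P[->|]; last exact: Kn_neg.
by rewrite KnE; exact: kbranch0.
Qed.

(** This default value lets the integral over [z <> x] of the ODE be taken over all [z], even when
    [mu] has an atom at [x]. *)
Lemma Kn3_0 : Kn 3 0 = 0.
Proof. by rewrite KnE sgr0 /kbranch !mulr0 mul0r subrr !(mul0r, mulr0). Qed.

(** Multiplied by the leading coefficient [alpha ^+ 4] of the operator, this is the unit jump that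
    makes K its Green's function. *)
Lemma kbranch3_jump : kbranch 3 1 0 - kbranch 3 (-1) 0 = (alpha ^+ 4)^-1.
Proof. by rewrite /kbranch !mulr0 oppr0 !mul0r expR0; field; exact: alpha_neq0. Qed.

Lemma kbranch3_opp : kbranch 3 (-1) 0 = - kbranch 3 1 0.
Proof. by rewrite /kbranch !mulr0 oppr0 !mul0r expR0; ring. Qed.

Let sqrN1 : (-1 : R) ^+ 2 = 1. Proof. by rewrite sqrrN expr1n. Qed.

Lemma is_derive_Kn n (x : R) : (n < 2)%N || (n < 3)%N && (x != 0) ->
  is_derive x 1 (Kn n) (Kn n.+1 x).
Proof.
case: (ltgtP x 0) => [x0|x0|->] nx; rewrite ?andbT ?andbF ?orbF in nx.
- rewrite Kn_neg//.
  apply: (@near_eq_is_derive _ _ _ (kbranch n (-1))).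
  + by near=> y; rewrite Kn_neg//; near: y; exact: lt_nbhsl.
  + apply: is_derive_kbranch => //; lia.
- rewrite Kn_pos//.
  apply: (@near_eq_is_derive _ _ _ (kbranch n 1)).
  + by near=> y; rewrite Kn_pos//; near: y; exact: lt_nbhsr.
  + by apply: is_derive_kbranch; [lia|exact: expr1n].
- have n3 : (n < 3)%N by lia.
  have n4 : (n < 4)%N by lia.
  apply: (@is_derive1_glue _ (kbranch n (-1)) (kbranch n 1)).
  + rewrite (_ : Kn _ _ = kbranch n.+1 (-1) 0); last by rewrite KnE; exact: kbranch0.
    exact: is_derive_kbranch.
  + rewrite (_ : Kn _ _ = kbranch n.+1 1 0); last by rewrite KnE; exact: kbranch0.
    by apply: is_derive_kbranch => //; rewrite expr1n.
  + by move=> y; exact: Kn_le0.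
  + by move=> y; exact: Kn_ge0.
Unshelve. all: by end_near. Qed.

Lemma Kn0E : Kn 0 = K.
Proof.
apply/funext => x; rewrite KnE /kbranch /Defs.K.
suff -> : Num.sg x * x = `|x| by [].
by rewrite normrEsg.
Qed.

Lemma derive1n3_K x : x != 0 -> derive1n 3 K x = Kn 3 x.
Proof.
move=> x0; rewrite !derive1nS derive1n0 -Kn0E.
rewrite (_ : derive1 (Kn 0) = Kn 1); last first.
  by apply/funext => y; apply: is_derive1E; exact: is_derive_Kn.
rewrite (_ : derive1 (Kn 1) = Kn 2); last first.
  by apply/funext => y; apply: is_derive1E; exact: is_derive_Kn.
by apply: is_derive1E; apply: is_derive_Kn.
Qed.

Lemma continuous_Kn2 : continuous (Kn 2).
Proof.
have -> : Kn 2 = fun x => - (4 * alpha ^+ 3)^-1 * (1 - `|x| / alpha) * expR (- `|x| / alpha).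
  by apply/funext => x; rewrite KnE /kbranch normrEsg.
move=> x; apply: cvgM; last first.
  apply: continuous_comp; last exact: continuous_expR.
  by apply: cvgMl; apply: cvgN; apply: cvg_norm.
apply: cvgMr; apply: cvgB; first exact: cvg_cst.
by apply: cvgMl; apply: cvg_norm.
Qed.

Lemma continuous_Kn n : (n < 3)%N -> continuous (Kn n).
Proof.
case: n => [|[|[|//]]] _; last exact: continuous_Kn2.
- by move=> x; exact: is_derive1_continuous (@is_derive_Kn 0 x isT).
- by move=> x; exact: is_derive1_continuous (@is_derive_Kn 1 x isT).
Qed.

Lemma continuous_Kn3 (x : R) : x != 0 -> {for x, continuous (Kn 3)}.
Proof.
have [x0|x0|//] := ltgtP x 0 => _.
- apply: (@is_derive1_continuous _ _ _ (kbranch 4 (-1) x)).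
  apply: (@near_eq_is_derive _ _ _ (kbranch 3 (-1))).
  + by near=> y; rewrite Kn_neg//; near: y; exact: lt_nbhsl.
  + exact: is_derive_kbranch.
- apply: (@is_derive1_continuous _ _ _ (kbranch 4 1 x)).
  apply: (@near_eq_is_derive _ _ _ (kbranch 3 1)).
  + by near=> y; rewrite Kn_pos//; near: y; exact: lt_nbhsr.
  + by apply: is_derive_kbranch => //; exact: expr1n.
Unshelve. all: by end_near. Qed.

Lemma measurable_Kn n : (n < 4)%N -> measurable_fun setT (Kn n).
Proof.
have msg : measurable_fun setT (Num.sg : R -> R).
  apply: nondecreasing_measurable => // x y.
  by case: (sgrP x); case: (sgrP y) => //; lra.
move=> n4; rewrite (funext (KnE _)) /kbranch; apply: measurable_funM; last first.
  apply: measurableT_comp => //; apply: measurable_funM => //.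
  by apply: measurableT_comp => //; exact: measurable_funM.
case: n n4 => [|[|[|[|//]]]] _.
- by apply: measurable_funM => //; apply: measurable_funD => //; exact: measurable_funM.
- by apply: measurable_funM.
- apply: measurable_funM => //; apply: measurable_funB => //.
  by apply: measurable_funM => //; exact: measurable_funM.
- apply: measurable_funM => //; apply: measurable_funB; exact: measurable_funM.
Qed.

(** One constant for the orders 0 to 3, which the four summands bound in turn, by
    [(1 + y) * expR (- y) <= 1] with [y] equal to [|x| / alpha]. *)
Definition Kbound : R := (4 * alpha ^+ 2)^-1 * alpha + (4 * alpha ^+ 3)^-1 * alpha +
  (4 * alpha ^+ 3)^-1 + (4 * alpha ^+ 4)^-1 * 2.

Lemma Kn_bound n x : (n < 4)%N -> `|Kn n x| <= Kbound.
Proof.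
move=> n4.
have xE : Num.sg x * x = `|x| by rewrite normrEsg.
have := normr_ge0 x; set y := `|x| / alpha => x0.
have y0 : 0 <= y by rewrite divr_ge0// ltW.
have yE : `|x| = alpha * y by rewrite /y; field; exact: alpha_neq0.
have E0 := expR_gt0 (- y); have E1 : (1 + y) * expR (- y) <= 1.
  by rewrite expRN ler_pdivrMr ?expR_gt0// mul1r expR_ge1Dx.
have yE0 : 0 <= y * expR (- y) by rewrite mulr_ge0// ltW.
have [p2 p3 p4] : [/\ 0 < (4 * alpha ^+ 2)^-1, 0 < (4 * alpha ^+ 3)^-1 &
    0 < (4 * alpha ^+ 4)^-1].
  by split; rewrite invr_gt0 mulr_gt0// exprn_gt0.
have [q2 q3] : 0 < (4 * alpha ^+ 2)^-1 * alpha /\ 0 < (4 * alpha ^+ 3)^-1 * alpha.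
  by split; rewrite mulr_gt0.
have le (k b u : R) : 0 < k -> `|u * expR (- y)| <= b -> `|k * u * expR (- y)| <= k * b.
  by move=> k0 ub; rewrite -mulrA normrM gtr0_norm// ler_wpM2l// ltW.
have eE : expR (- (Num.sg x * x) / alpha) = expR (- y) by rewrite xE mulNr.
have sgx1 : `|Num.sg x| <= 1 by rewrite normr_sg lern1 leq_b1.
rewrite KnE /Kbound; case: n n4 => [|[|[|[|//]]]] _; rewrite /kbranch eE.
- rewrite xE yE (_ : alpha + alpha * y = alpha * (1 + y)); last by ring.
  rewrite mulrA (le_trans (le _ 1 _ q2 _))//; last by lra.
  by rewrite ger0_norm//; lra.
- rewrite mulNr mulNr normrN normrM normrM yE.
  rewrite (_ : _ * _ = `|(4 * alpha ^+ 3)^-1| * alpha * (y * expR (- y))); last first.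
    by rewrite (gtr0_norm E0); ring.
  rewrite (gtr0_norm p3).
  have : (4 * alpha ^+ 3)^-1 * alpha * (y * expR (- y)) <= (4 * alpha ^+ 3)^-1 * alpha * 1.
    by rewrite ler_wpM2l//; lra.
  lra.
- rewrite xE yE (_ : alpha * y / alpha = y); last by field; exact: alpha_neq0.
  rewrite mulNr mulNr normrN (le_trans (le _ 1 _ p3 _))//; last by lra.
  by rewrite ler_norml; lra.
- rewrite (le_trans (le _ 2 _ p4 _))//; last by lra.
  rewrite normrM (gtr0_norm E0).
  have : `|2 * Num.sg x - x / alpha| <= 2 + y.
    rewrite (le_trans (ler_normB _ _))// lerD//.
      by rewrite normrM (ger0_norm (ler0n _ 2)); lra.
    by rewrite normrM normfV (gtr0_norm alpha_gt0).
  by move=> /(ler_wpM2r (ltW E0)); lra.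
Qed.

End kernel.

Section norm_bounds.
Context {R : realType}.
Implicit Types a b A B : R.

Lemma le_normM a b A B : `|a| <= A -> `|b| <= B -> `|a * b| <= A * B.
Proof. by move=> aA bB; rewrite normrM ler_pM. Qed.

Lemma le_normD a b A B : `|a| <= A -> `|b| <= B -> `|a + b| <= A + B.
Proof. by move=> aA bB; rewrite (le_trans (ler_normD _ _))// lerD. Qed.

Lemma le_normB a b A B : `|a| <= A -> `|b| <= B -> `|a - b| <= A + B.
Proof. by move=> aA bB; rewrite (le_trans (ler_normB _ _))// lerD. Qed.

Lemma le_normX2 a A : `|a| <= A -> `|a ^+ 2| <= A ^+ 2.
Proof. by move=> aA; rewrite !expr2; exact: le_normM. Qed.

End norm_bounds.

(** * Integration of compactly supported functions *)

Section compact_support.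
Context {R : realType}.
Local Notation leb := (@lebesgue_measure R).

Lemma integrable_compact_support (f : R -> R) (C B : R) :
  measurable_fun setT f -> (forall x, `|f x| <= C) ->
  (forall x, B < `|x| -> f x = 0) -> leb.-integrable setT (EFin \o f).
Proof.
move=> mf fC f0.
apply: (@integrable_dominated _ _ _ leb _ (fun x => C * \1_`[(- B), B] x)) => //.
  by apply: integrable_EFinZ; exact: integrable_indic_itv.
move=> x; rewrite indicE; case: (boolP (x \in _)) => [_|]; first by rewrite mulr1.
by rewrite mem_setE in_itv/= -ler_norml -ltNge => /f0 ->; rewrite normr0 mulr0.
Qed.

Lemma Rfubini_compact_support d (T : measurableType d)
    (m : {finite_measure set T -> \bar R}) (q : R * T -> R) (C B : R) :
  measurable_fun setT (q : measurableTypeR R * T -> R) ->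
  (forall z, `|q z| <= C) -> (forall x y, B < `|x| -> q (x, y) = 0) ->
  \int[leb]_x \int[m]_y q (x, y) = \int[m]_y \int[leb]_x q (x, y).
Proof.
move=> mq qC q0.
apply: (@Rfubini R _ _ (measurableTypeR R) _ leb m q (fun x => C * \1_`[(- B), B] x)) => //.
  by apply: integrable_EFinZ; exact: integrable_indic_itv.
move=> x y; rewrite indicE; case: (boolP (x \in _)) => [_|]; first by rewrite mulr1.
by rewrite mem_setE in_itv/= -ler_norml -ltNge => /q0 ->; rewrite normr0 mulr0.
Qed.

Lemma continuous_compact_support_bounded (f : R -> R) (B : R) :
  continuous f -> (forall x, B < `|x| -> f x = 0) ->
  exists C : R, forall x, `|f x| <= C.
Proof.
move=> cf f0.
have : compact [set f x | x in `[(- B), B]].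
  apply: continuous_compact; last exact: segment_compact.
  exact: continuous_subspaceT.
move=> /compact_bounded [C [_ CP]].
exists (`|C| + 1) => x; have [xB|/f0 ->] := leP `|x| B; last by rewrite normr0.
apply: CP; first by rewrite (le_lt_trans (ler_norm C))// ltrDl.
by exists x => //=; rewrite in_itv/= -ler_norml.
Qed.

Lemma measurable_fun_continuous (f : R -> R) : continuous f -> measurable_fun setT f.
Proof. exact: continuous_measurable_fun. Qed.

End compact_support.

(** * The potential of a finite measure *)

Section potential.
Context {R : realType} (alpha : R).
Hypothesis alpha_gt0 : 0 < alpha.
Variable nu : {finite_measure set (measurableTypeR R) -> \bar R}.
Local Notation leb := (@lebesgue_measure R).
Local Notation Kn := (Kn alpha).
Local Notation Kbound := (Kbound alpha).
Local Notation kbranch := (kbranch alpha).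

(** For [n = 3] the value at an atom of [nu] is the mean of the one-sided limits, since
    [Kn 3 0 = 0]. The choice matters: the ODE evaluates this function at the atoms. *)
Definition potential (n : nat) (x : R) : R := \int[nu]_y Kn n (x - y).
Local Notation U := potential.

Lemma measurable_Kn_sub n : (n < 4)%N ->
  measurable_fun setT (fun z : measurableTypeR R * measurableTypeR R => Kn n (z.1 - z.2)).
Proof.
move=> n4; apply: (measurableT_comp (measurable_Kn _ n4)) => //.
exact: measurable_funB.
Qed.

Lemma measurable_Kn_subl n x : (n < 4)%N ->
  measurable_fun setT (fun y : measurableTypeR R => Kn n (x - y)).
Proof.
by move=> n4; apply: (measurableT_comp (measurable_Kn _ n4)) => //; exact: measurable_funB.
Qed.

Lemma measurable_Kn_subr n y : (n < 4)%N ->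
  measurable_fun setT (fun x : measurableTypeR R => Kn n (x - y)).
Proof.
by move=> n4; apply: (measurableT_comp (measurable_Kn _ n4)) => //; exact: measurable_funB.
Qed.

Lemma integrable_Kn n x : (n < 4)%N ->
  nu.-integrable setT (EFin \o (fun y => Kn n (x - y))).
Proof.
move=> n4; apply: (@integrable_bounded _ _ _ nu _ Kbound).
  exact: measurable_Kn_subl.
by move=> y; exact: Kn_bound.
Qed.

Lemma potential_bound n x : (n < 4)%N -> `|U n x| <= Kbound * fine (nu setT).
Proof.
move=> n4; apply: le_norm_Rintegral; first exact: measurable_Kn_subl.
by move=> y; exact: Kn_bound.
Qed.

Lemma measurable_potential n : (n < 4)%N -> measurable_fun setT (U n).
Proof.
move=> n4.
apply: (@measurable_fun_Rintegral R _ _ (measurableTypeR R) (measurableTypeR R)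
  nu (fun z => Kn n (z.1 - z.2)) Kbound) => //.
  exact: measurable_Kn_sub.
by move=> z; exact: Kn_bound.
Qed.

Lemma continuous_potential n : (n < 3)%N -> continuous (U n).
Proof.
move=> n3 x.
have n4 : (n < 4)%N by lia.
apply: (@continuous_at_Rintegral _ _ _ nu (fun x y => Kn n (x - y)) (cst Kbound)).
- by move=> t; exact: measurable_Kn_subl.
- exact: finite_measure_integrable_cst.
- by move=> t y; exact: Kn_bound.
- apply: aeW => y; apply: (@continuous_comp _ _ _ (fun x => x - y) (Kn n)).
    by apply: cvgB; [exact: cvg_id|exact: cvg_cst].
  exact: continuous_Kn.
Qed.

Lemma is_derive_potential n (x : R) : (n < 2)%N -> is_derive x 1 (U n) (U n.+1 x).
Proof.
move=> n2.
have n4 : (n < 4)%N by lia.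
have dK y (z : R) : is_derive z 1 (fun x => Kn n (x - y)) (Kn n.+1 (z - y)).
  by apply: is_derive1_shift; apply: is_derive_Kn => //; rewrite n2.
have xI : `]x - 1, x + 1[%classic x by rewrite /= in_itv/=; lra.
have H1 : forall x0 : R, `]x - 1, x + 1[%classic x0 ->
    nu.-integrable setT (EFin \o (fun y => Kn n (x0 - y))).
  by move=> z _; exact: integrable_Kn.
have H2 : forall (x0 : R) y, `]x - 1, x + 1[%classic x0 -> [set: R] y ->
    derivable (fun x => Kn n (x - y)) x0 1.
  by move=> z y _ _; apply: ex_derive.
have H3 (y : R) : 0 <= cst Kbound y.
  exact: (le_trans (normr_ge0 (Kn n 0)) (Kn_bound alpha_gt0 _ n4)).
have H4 : nu.-integrable setT (EFin \o cst Kbound).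
  exact: finite_measure_integrable_cst.
have H5 : forall x0 y, `]x - 1, x + 1[%classic x0 -> [set: R] y ->
    `|partial1of2 (fun x y => Kn n (x - y)) x0 y| <= cst Kbound y.
  move=> z y _ _; rewrite /partial1of2 (is_derive1E (dK y z)).
  by apply: Kn_bound => //; lia.
have := derivable_under_integral measurableT xI H1 H2 H3 H4 H5.
move=> /derivable_is_derive1.
rewrite (differentiation_under_integral measurableT xI H1 H2 H3 H4 H5).
by under eq_Rintegral do rewrite /partial1of2 (is_derive1E (dK _ _)).
Qed.

Lemma continuous_shift (f : R -> R) (y : R) :
  continuous f -> continuous (fun x => f (x - y)).
Proof.
move=> cf x; apply: (@continuous_comp _ _ _ (fun x => x - y) f); last exact: cf.
by apply: cvgB; [exact: cvg_id|exact: cvg_cst].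
Qed.

Lemma measurable_fun_fst (f : R -> R) : measurable_fun setT f ->
  measurable_fun setT (fun z : measurableTypeR R * measurableTypeR R => f z.1).
Proof. by move=> mf; apply: measurableT_comp mf _. Qed.

Let Kbound_ge0 : 0 <= Kbound.
Proof. exact: le_trans (normr_ge0 _) (Kn_bound alpha_gt0 0 (isT : (0 < 4)%N)). Qed.

Let sqrN1 : (-1 : R) ^+ 2 = 1. Proof. by rewrite sqrrN expr1n. Qed.
Let sqr1 : (1 : R) ^+ 2 = 1. Proof. exact: expr1n. Qed.

Let Kn_subl n x y : x < y -> Kn n (x - y) = kbranch n (-1) (x - y).
Proof. by move=> xy; rewrite Kn_neg// subr_lt0. Qed.

Let Kn_subr n x y : y < x -> Kn n (x - y) = kbranch n 1 (x - y).
Proof. by move=> xy; rewrite Kn_pos// subr_gt0. Qed.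

Let is_derive_kbranch_sub n s (y x : R) : (n < 4)%N -> s ^+ 2 = 1 ->
  is_derive x 1 (fun x => kbranch n s (x - y)) (kbranch n.+1 s (x - y)).
Proof. by move=> n4 s1; apply: is_derive1_shift; exact: is_derive_kbranch. Qed.

Let continuous_kbranch_sub n s (y : R) : (n < 4)%N -> s ^+ 2 = 1 ->
  continuous (fun x => kbranch n s (x - y)).
Proof. by move=> n4 s1; apply: continuous_shift; exact: continuous_kbranch. Qed.

(** By Fubini this is integration by parts against one translate of the kernel; the boundary terms
    at [y] cancel because the derivatives of order below three are continuous at 0. Hence the third
    distributional derivative is still a function. *)
Lemma Rintegral_potential_by_parts n (psi dpsi : R -> R) (B : R) : (n < 3)%N ->
  (forall x : R, is_derive x 1 psi (dpsi x)) -> continuous dpsi ->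
  (forall x, B < `|x| -> psi x = 0 /\ dpsi x = 0) ->
  \int[leb]_x (potential n x * dpsi x) = - \int[leb]_x (potential n.+1 x * psi x).
Proof.
move=> n3 dP cdP psi0; have [n4 n14] : (n < 4)%N /\ (n.+1 < 4)%N by lia.
have cP : continuous psi by move=> x; exact: is_derive1_continuous (dP x).
have [C1 C1P] := continuous_compact_support_bounded cP (fun x Bx => (psi0 x Bx).1).
have [C2 C2P] := continuous_compact_support_bounded cdP (fun x Bx => (psi0 x Bx).2).
have int_mul m (f : R -> R) (C : R) : (m < 4)%N -> continuous f -> (forall x, `|f x| <= C) ->
    (forall x, B < `|x| -> f x = 0) ->
    leb.-integrable setT (EFin \o (fun x => potential m x * f x)).
  move=> m4 cf fC f0.
  apply: (@integrable_compact_support _ _ (Kbound * fine (nu setT) * C) B).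
  - apply: measurable_funM; first exact: measurable_potential.
    exact: measurable_fun_continuous.
  - by move=> x; rewrite normrM ler_pM// potential_bound.
  - by move=> x /f0 ->; rewrite mulr0.
pose q (z : R * R) := Kn n (z.1 - z.2) * dpsi z.1 + Kn n.+1 (z.1 - z.2) * psi z.1.
have qE x : \int[nu]_y q (x, y) = potential n x * dpsi x + potential n.+1 x * psi x.
  rewrite /q /= RintegralD//.
  - by rewrite !RintegralZr//; exact: integrable_Kn.
  - under eq_fun do rewrite mulrC; apply: integrable_EFinZ; exact: integrable_Kn.
  - under eq_fun do rewrite mulrC; apply: integrable_EFinZ; exact: integrable_Kn.
apply/eqP; rewrite -addr_eq0 -RintegralD//; last 2 first.
- by apply: (int_mul _ _ C2) => // x /psi0[].
- by apply: (int_mul _ _ C1) => // x /psi0[].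
under eq_Rintegral do rewrite -qE.
rewrite (@Rfubini_compact_support _ _ _ nu q (Kbound * C2 + Kbound * C1) B); last 3 first.
- apply: measurable_funD; apply: measurable_funM.
  + exact: measurable_Kn_sub.
  + by apply: measurable_fun_fst; exact: measurable_fun_continuous.
  + exact: measurable_Kn_sub.
  + by apply: measurable_fun_fst; exact: measurable_fun_continuous.
- move=> z; rewrite /q (le_trans (ler_normD _ _))// !normrM.
  by apply: lerD; apply: ler_pM => //; exact: Kn_bound.
- by move=> x y /psi0[p0 dp0]; rewrite /q /= p0 dp0 !mulr0 addr0.
apply/eqP; rewrite [RHS](_ : 0 = \int[nu]_y 0); last first.
  by rewrite Rintegral_cst// mul0r.
apply: eq_Rintegral => y _.
pose F s (x : R) := kbranch n s (x - y) * psi x.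
pose f s (x : R) := kbranch n s (x - y) * dpsi x + kbranch n.+1 s (x - y) * psi x.
have dF s (x : R) : s ^+ 2 = 1 -> is_derive x 1 (F s) (f s x).
  move=> s1; have := is_derive_kbranch_sub y x n4 s1; have := dP x.
  move=> ? ?; derive1_auto; by rewrite /f; ring.
have cf s : s ^+ 2 = 1 -> continuous (f s).
  move=> s1 x; apply: cvgD; apply: cvgM; try exact: continuous_kbranch_sub.
  - exact: cdP.
  - exact: cP.
(* Both breaks are placed at [y], so that the middle interval is empty. *)
transitivity (F (-1) y - F 1 y + F 1 y - F 1 y); last first.
  by rewrite /F subrr (kbranch0 _ (-1) 1 n3); ring.
apply: (@Rintegral_two_breaks _ y y B (fun x => q (x, y))
  (F (-1)) (f (-1)) (F 1) (f 1) (F 1) (f 1)) => //.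
- by move=> x; exact: dF.
- exact: cf.
- by move=> x; exact: dF.
- exact: cf.
- by move=> x; exact: dF.
- exact: cf.
- by move=> x xy; rewrite /q /= !Kn_subl.
- by move=> x; lra.
- by move=> x xy; rewrite /q /= !Kn_subr.
- apply: measurable_funD; apply: measurable_funM.
  + exact: measurable_Kn_subr.
  + exact: measurable_fun_continuous.
  + exact: measurable_Kn_subr.
  + exact: measurable_fun_continuous.
- by move=> x /psi0[p0 dp0]; rewrite /q /F /= p0 dp0 !mulr0 addr0.
Qed.

(** After Fubini, this is the Green identity for one translate of K; [th] lists a test function and
    its successive derivatives. *)
Lemma Rintegral_potential_green (th : nat -> R -> R) (B : R) :
  (forall n (x : R), is_derive x 1 (th n) (th n.+1 x)) ->
  (forall n x, B < `|x| -> th n x = 0) ->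
  \int[leb]_x (potential 0 x *
    (th 0%N x - 2 * alpha ^+ 2 * th 2%N x + alpha ^+ 4 * th 4%N x)) =
  \int[nu]_y th 0%N y.
Proof.
move=> dth th0.
have cth n : continuous (th n) by move=> x; exact: is_derive1_continuous (dth n x).
pose L x := th 0%N x - 2 * alpha ^+ 2 * th 2%N x + alpha ^+ 4 * th 4%N x.
have cL : continuous L.
  move=> x; apply: cvgD; last by apply: cvgMr; exact: cth.
  by apply: cvgB; [exact: cth|apply: cvgMr; exact: cth].
have L0 x : B < `|x| -> L x = 0.
  by move=> xB; rewrite /L !th0// !mulr0 subrr addr0.
have [C LC] := continuous_compact_support_bounded cL L0.
pose q (z : R * R) := Kn 0 (z.1 - z.2) * L z.1.
transitivity (\int[leb]_x \int[nu]_y q (x, y)).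
  by apply: eq_Rintegral => x _; rewrite /q /= RintegralZr//; exact: integrable_Kn.
rewrite (@Rfubini_compact_support _ _ _ nu q (Kbound * C) B); last 3 first.
- apply: measurable_funM; first exact: measurable_Kn_sub.
  by apply: measurable_fun_fst; exact: measurable_fun_continuous.
- by move=> z; rewrite normrM; apply: ler_pM => //; exact: Kn_bound.
- by move=> x y /L0 Lx; rewrite /q /= Lx mulr0.
apply: eq_Rintegral => y _.
pose k n s (x : R) := kbranch n s (x - y).
(* [F] collects the boundary terms of moving all derivatives from [th] to the kernel; on either side
   of [y], [kbranch_ode] cancels the terms in which the kernel alone is differentiated. *)
pose F s (x : R) := - (2 * alpha ^+ 2) * (k 0%N s x * th 1%N x - k 1%N s x * th 0%N x) +
  alpha ^+ 4 * (k 0%N s x * th 3%N x - k 1%N s x * th 2%N x + k 2%N s x * th 1%N x - k 3%N s x * th 0%N x).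
pose f s (x : R) := k 0%N s x * L x.
have ck n s : (n < 4)%N -> s ^+ 2 = 1 -> continuous (k n s).
  by move=> n4 s1; exact: continuous_kbranch_sub.
have dF s (x : R) : s ^+ 2 = 1 -> is_derive x 1 (F s) (f s x).
  move=> s1.
  have dk n : (n < 4)%N -> is_derive x 1 (k n s) (k n.+1 s x).
    by move=> n4; exact: is_derive_kbranch_sub.
  have dk0 := dk 0%N isT; have dk1 := dk 1%N isT; have dk2 := dk 2%N isT; have dk3 := dk 3%N isT.
  have d0 := dth 0%N x; have d1 := dth 1%N x; have d2 := dth 2%N x; have d3 := dth 3%N x.
  rewrite /F; derive1_auto.
  have k4 : k 4%N s x = - (k 0%N s x - 2 * alpha ^+ 2 * k 2%N s x) / alpha ^+ 4.
    exact: kbranch_ode.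
  rewrite /= k4 /f /L; field; by rewrite gt_eqF.
have cf s : s ^+ 2 = 1 -> continuous (f s).
  by move=> s1 x; apply: cvgM; [exact: ck|exact: cL].
(* All terms of [F] are continuous at [y] except the one in [k 3], whose jump returns the value of
   the test function. *)
transitivity (F (-1) y - F 1 y + F 1 y - F 1 y); last first.
  rewrite addrK /F /k subrr !(kbranch0 _ (-1) 1 (isT : (0 < 3)%N)) !(kbranch0 _ (-1) 1 (isT : (1 < 3)%N))
    !(kbranch0 _ (-1) 1 (isT : (2 < 3)%N)).
  rewrite (_ : _ - _ = alpha ^+ 4 * th 0%N y * (kbranch 3 1 0 - kbranch 3 (-1) 0)); last by ring.
  by rewrite kbranch3_jump//; field; rewrite gt_eqF.
apply: (@Rintegral_two_breaks _ y y B (fun x => q (x, y))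
  (F (-1)) (f (-1)) (F 1) (f 1) (F 1) (f 1)).
- exact: lexx.
- by move=> x; exact: dF.
- exact: cf.
- by move=> x; exact: dF.
- exact: cf.
- by move=> x; exact: dF.
- exact: cf.
- by move=> x xy; rewrite /q /= !Kn_subl.
- by move=> x; lra.
- by move=> x xy; rewrite /q /= !Kn_subr.
- apply: measurable_funM; last exact: measurable_fun_continuous.
  exact: measurable_Kn_subr.
- move=> x xB; rewrite /q /= L0// mulr0; split=> //.
  by rewrite /F !th0// !(mulr0, subr0, addr0).
Qed.

(* Away from [y] and [y'], the integrand is the derivative of
   [- alpha ^+ 4 * g x * K'''(x - y) * K'''(x - y')], because
   [alpha^4 K'''' = - (K - 2 alpha^2 K'')] there; only the jumps contribute. *)
Lemma Rintegral_kernel_pair (g dg : R -> R) (B y y' : R) :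
  (forall x : R, is_derive x 1 g (dg x)) -> continuous dg ->
  (forall x, B < `|x| -> g x = 0 /\ dg x = 0) ->
  \int[leb]_x (g x *
     ((Kn 0 (x - y) - 2 * alpha ^+ 2 * Kn 2 (x - y)) * Kn 3 (x - y') +
      (Kn 0 (x - y') - 2 * alpha ^+ 2 * Kn 2 (x - y')) * Kn 3 (x - y)) -
     alpha ^+ 4 * dg x * (Kn 3 (x - y) * Kn 3 (x - y'))) =
  g y * Kn 3 (y - y') + g y' * Kn 3 (y' - y).
Proof.
move=> dG cdG g0.
have cg : continuous g by move=> x; exact: is_derive1_continuous (dG x).
wlog yy' : y y' / y <= y'.
  move=> H; have [/H //|/ltW /H] := leP y y'.
  rewrite [in RHS]addrC => <-; apply: eq_Rintegral => x _; ring.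
pose k n s (y x : R) := kbranch n s (x - y).
pose P s y x := k 0%N s y x - 2 * alpha ^+ 2 * k 2%N s y x.
(* [s] and [s'] record on which side of [y] and of [y'] the point [x] lies; between the two they are
   1 and -1. *)
pose F s s' (x : R) := - alpha ^+ 4 * (g x * (k 3%N s y x * k 3%N s' y' x)).
pose f s s' (x : R) := g x * (P s y x * k 3%N s' y' x + P s' y' x * k 3%N s y x) -
  alpha ^+ 4 * dg x * (k 3%N s y x * k 3%N s' y' x).
have ck n s z : (n < 4)%N -> s ^+ 2 = 1 -> continuous (k n s z).
  by move=> n4 s1; exact: continuous_kbranch_sub.
have cP s z : s ^+ 2 = 1 -> continuous (P s z).
  by move=> s1 x; apply: cvgB; [exact: ck|apply: cvgMr; exact: ck].
have dF s s' (x : R) : s ^+ 2 = 1 -> s' ^+ 2 = 1 -> is_derive x 1 (F s s') (f s s' x).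
  move=> s1 s1'; have dg' := dG x.
  have d1 : is_derive x 1 (k 3%N s y) (k 4%N s y x) by exact: is_derive_kbranch_sub.
  have d2 : is_derive x 1 (k 3%N s' y') (k 4%N s' y' x) by exact: is_derive_kbranch_sub.
  have k4 s0 z : k 4%N s0 z x = - P s0 z x / alpha ^+ 4 by exact: kbranch_ode.
  rewrite /F; derive1_auto; rewrite !k4 /f; field; by rewrite gt_eqF.
have cf s s' : s ^+ 2 = 1 -> s' ^+ 2 = 1 -> continuous (f s s').
  move=> s1 s1' x; apply: cvgB.
    apply: cvgM; first exact: cg.
    by apply: cvgD; apply: cvgM; [exact: cP|exact: ck|exact: cP|exact: ck].
  apply: cvgM; last by apply: cvgM; exact: ck.
  by apply: cvgMr; exact: cdG.
transitivity (F (-1) (-1) y - F 1 (-1) y + F 1 (-1) y' - F 1 1 y'); last first.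
  have a0 : alpha ^+ 4 != 0 by rewrite expf_neq0// gt_eqF.
  rewrite /F /k !subrr.
  transitivity (alpha ^+ 4 * (kbranch 3 1 0 - kbranch 3 (-1) 0) *
    (g y * kbranch 3 (-1) (y - y') + g y' * kbranch 3 1 (y' - y))); first ring.
  rewrite kbranch3_jump// divff// mul1r.
  (* For [y = y'] both sides vanish: the one-sided values of K''' at 0 are opposite, and
     [Kn 3 0 = 0]. *)
  move: yy'; rewrite le_eqVlt => /predU1P[->|yy'].
    by rewrite subrr Kn3_0// kbranch3_opp; ring.
  by rewrite Kn_subl// Kn_subr.
apply: (@Rintegral_two_breaks _ y y' B _ (F (-1) (-1)) (f (-1) (-1))
  (F 1 (-1)) (f 1 (-1)) (F 1 1) (f 1 1)).
- exact: yy'.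
- by move=> x; exact: dF.
- exact: cf.
- by move=> x; exact: dF.
- exact: cf.
- by move=> x; exact: dF.
- exact: cf.
- by move=> x xy; rewrite !(Kn_subl _ xy) !(Kn_subl _ (lt_le_trans xy yy')).
- by move=> x /andP[yx xy']; rewrite !(Kn_subl _ xy') !(Kn_subr _ yx).
- by move=> x xy; rewrite !(Kn_subr _ xy) !(Kn_subr _ (le_lt_trans yy' xy)).
- have mk n z : (n < 4)%N -> measurable_fun setT (fun x : measurableTypeR R => Kn n (x - z)).
    exact: measurable_Kn_subr.
  apply: measurable_funB; apply: measurable_funM.
  + exact: measurable_fun_continuous.
  + apply: measurable_funD; apply: measurable_funM; try exact: mk.
    * by apply: measurable_funB; [exact: mk|apply: measurable_funM => //; exact: mk].
    * by apply: measurable_funB; [exact: mk|apply: measurable_funM => //; exact: mk].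
  + by apply: measurable_funM => //; exact: measurable_fun_continuous.
  + by apply: measurable_funM; exact: mk.
- by move=> x /g0[gx dgx]; rewrite /F gx dgx !(mul0r, mulr0) subrr.
Qed.

(* Expand the square [potential 3 x ^+ 2] into a double integral against [nu],
   exchange integrals, and symmetrize. *)
Lemma Rintegral_potential_cubic (g dg : R -> R) (B : R) :
  (forall x : R, is_derive x 1 g (dg x)) -> continuous dg ->
  (forall x, B < `|x| -> g x = 0 /\ dg x = 0) ->
  \int[leb]_x (g x * (potential 0 x - 2 * alpha ^+ 2 * potential 2 x) * potential 3 x -
     2^-1 * alpha ^+ 4 * dg x * potential 3 x ^+ 2) =
  \int[nu]_y (g y * potential 3 y).
Proof.
move=> dG cdG g0.
have cg : continuous g by move=> x; exact: is_derive1_continuous (dG x).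
have mg : measurable_fun setT g by exact: measurable_fun_continuous.
have mdg : measurable_fun setT dg by exact: measurable_fun_continuous.
have [C CP] := continuous_compact_support_bounded cg (fun x Bx => (g0 x Bx).1).
have [D DP] := continuous_compact_support_bounded cdG (fun x Bx => (g0 x Bx).2).
have C0 : 0 <= C by exact: le_trans (normr_ge0 _) (CP 0).
have D0 : 0 <= D by exact: le_trans (normr_ge0 _) (DP 0).
have m0 : 0 <= fine (nu setT) by rewrite fine_ge0.
pose P x := Kn 0 x - 2 * alpha ^+ 2 * Kn 2 x.
(* The existentials make [PU] and [U3] opaque, so that algebra and rewriting do not see the
   integrals behind them. *)
have [PU PUdef] : exists PU : R -> R, forall x,
    PU x = potential 0 x - 2 * alpha ^+ 2 * potential 2 x by eexists.
have [U3 U3def] : exists U3 : R -> R, U3 = potential 3 by exists (potential 3).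
pose PB : R := Kbound + 2 * alpha ^+ 2 * Kbound.
have a2 : 0 <= 2 * alpha ^+ 2 by rewrite mulr_ge0// sqr_ge0.
have Pbound x : `|P x| <= PB.
  rewrite (le_trans (ler_normB _ _))// lerD ?Kn_bound// normrM ger0_norm//.
  by rewrite ler_wpM2l// Kn_bound.
have PB0 : 0 <= PB by exact: le_trans (normr_ge0 _) (Pbound 0).
have mP : measurable_fun setT P.
  by apply: measurable_funB; last apply: measurable_funM => //; exact: measurable_Kn.
have iP x : nu.-integrable setT (EFin \o (fun y => P (x - y))).
  apply: (@integrable_bounded _ _ _ nu _ PB) => //.
  by apply: (measurableT_comp mP) => //; exact: measurable_funB.
have iK x : nu.-integrable setT (EFin \o (fun y => Kn 3 (x - y))) by exact: integrable_Kn.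
have PUE x : PU x = \int[nu]_y P (x - y).
  rewrite PUdef RintegralB//; [|exact: integrable_Kn|by apply: integrable_EFinZ; exact: integrable_Kn].
  by rewrite RintegralZl//; exact: integrable_Kn.
have PUbound x : `|PU x| <= PB * fine (nu setT).
  rewrite PUE; apply: le_norm_Rintegral => //.
  by apply: (measurableT_comp mP) => //; exact: measurable_funB.
have U3E x : U3 x = \int[nu]_y Kn 3 (x - y) by rewrite U3def.
have U3bound x : `|U3 x| <= Kbound * fine (nu setT) by rewrite U3def potential_bound.
have mU3 : measurable_fun setT U3 by rewrite U3def; exact: measurable_potential.
have mPU : measurable_fun setT PU.
  rewrite (funext PUdef).
  by apply: measurable_funB; last apply: measurable_funM => //; exact: measurable_potential.
pose q x y y' := g x * (P (x - y) * Kn 3 (x - y') + P (x - y') * Kn 3 (x - y)) -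
  alpha ^+ 4 * dg x * (Kn 3 (x - y) * Kn 3 (x - y')).
(* [F] is [q] already integrated in [y']; it reduces the triple integral to successive exchanges of
   two variables. *)
pose F (z : R * R) := g z.1 * (P (z.1 - z.2) * U3 z.1 + PU z.1 * Kn 3 (z.1 - z.2)) -
  alpha ^+ 4 * dg z.1 * (Kn 3 (z.1 - z.2) * U3 z.1).
have FE x y : \int[nu]_y' q x y y' = F (x, y).
  rewrite (_ : F (x, y) = (g x * P (x - y) - alpha ^+ 4 * dg x * Kn 3 (x - y)) * U3 x +
    (g x * Kn 3 (x - y)) * PU x); last by rewrite /F /=; ring.
  rewrite PUE U3E -!RintegralZl// -RintegralD//; try exact: integrable_EFinZ.
  by apply: eq_Rintegral => y' _; rewrite /q; ring.
have FI x : \int[nu]_y F (x, y) = 2 * (g x * PU x * U3 x -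
     2^-1 * alpha ^+ 4 * dg x * U3 x ^+ 2).
  transitivity ((g x * U3 x) * PU x + (g x * PU x - alpha ^+ 4 * dg x * U3 x) * U3 x); last by field.
  rewrite [in X in X + _]PUE [X in _ + _ * X]U3E -!RintegralZl// -RintegralD//; try exact: integrable_EFinZ.
  by apply: eq_Rintegral => y _; rewrite /F /=; ring.
have mF : measurable_fun setT (F : measurableTypeR R * measurableTypeR R -> R).
  have mK : measurable_fun setT (fun z : measurableTypeR R * measurableTypeR R => Kn 3 (z.1 - z.2)).
    exact: measurable_Kn_sub.
  apply: measurable_funB; apply: measurable_funM.
  - exact: measurable_fun_fst.
  - apply: measurable_funD; apply: measurable_funM => //.
    + by apply: (measurableT_comp mP) => //; exact: measurable_funB.
    + exact: (measurable_fun_fst mU3).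
    + exact: (measurable_fun_fst mPU).
  - by apply: measurable_funM => //; exact: measurable_fun_fst.
  - by apply: measurable_funM => //; exact: (measurable_fun_fst mU3).
have K3b x : `|Kn 3 x| <= Kbound by exact: Kn_bound.
have Fb z : `|F z| <= C * (PB * (Kbound * fine (nu setT)) + PB * fine (nu setT) * Kbound) +
    alpha ^+ 4 * D * (Kbound * (Kbound * fine (nu setT))).
  by apply: le_normB; apply: le_normM => //; do ?apply: le_normD; do ?apply: le_normM => //;
    rewrite gtr0_norm.
have iS : leb.-integrable setT (EFin \o (fun x => g x * PU x * U3 x -
    2^-1 * alpha ^+ 4 * dg x * U3 x ^+ 2)).
  pose N := fine (nu setT).
  apply: (@integrable_compact_support _ _ (C * (PB * N) * (Kbound * N) +
    `|2^-1 * alpha ^+ 4| * D * (Kbound * N) ^+ 2) B).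
  - apply: measurable_funB; apply: measurable_funM => //.
    + exact: measurable_funM.
    + exact: measurable_funM.
    + exact: measurable_funX.
  - by move=> x; apply: le_normB; apply: le_normM; do ?apply: le_normM; do ?apply: le_normX2.
  - by move=> x /g0[-> ->]; rewrite !(mul0r, mulr0) subrr.
rewrite -U3def; under eq_Rintegral do rewrite -PUdef.
(* [q] is symmetric in its two points, so its double integral against [nu] is twice the integrand on
   the left: this is the origin of the factor [2^-1]. *)
apply: (mulfI (_ : 2 != 0)); first by rewrite pnatr_eq0.
rewrite -RintegralZl//; under eq_Rintegral do rewrite -FI.
rewrite (@Rfubini_compact_support _ _ _ nu F _ B mF Fb); last first.
  by move=> x y /g0[gx dgx]; rewrite /F /= gx dgx !(mul0r, mulr0) subrr.
have gb y y' : `|g y * Kn 3 (y - y')| <= C * Kbound.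
  by rewrite normrM ler_pM.
have mgK : measurable_fun setT
    (fun z : measurableTypeR R * measurableTypeR R => g z.1 * Kn 3 (z.1 - z.2)).
  by apply: measurable_funM; [exact: (measurable_fun_fst mg)|exact: measurable_Kn_sub].
have mgK' : measurable_fun setT
    (fun z : measurableTypeR R * measurableTypeR R => g z.2 * Kn 3 (z.2 - z.1)).
  by have := measurableT_comp mgK (@measurable_swap _ _ (measurableTypeR R) (measurableTypeR R)).
have FJ y : \int[leb]_x F (x, y) = g y * U3 y + \int[nu]_y' (g y' * Kn 3 (y' - y)).
  under eq_Rintegral do rewrite -FE.
  rewrite (@Rfubini_compact_support _ _ _ nu (fun z => q z.1 y z.2)
    (C * (PB * Kbound + PB * Kbound) + alpha ^+ 4 * D * (Kbound * Kbound)) B); last 3 first.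
  - have mPy : measurable_fun setT (fun x : measurableTypeR R => P (x - y)).
      by apply: (measurableT_comp mP) => //; exact: measurable_funB.
    apply: measurable_funB; apply: measurable_funM.
    + exact: (measurable_fun_fst mg).
    + apply: measurable_funD; apply: measurable_funM.
      * exact: (measurable_fun_fst mPy).
      * exact: measurable_Kn_sub.
      * by apply: (measurableT_comp mP) => //; exact: measurable_funB.
      * exact: (measurable_fun_fst (measurable_Kn_subr y (isT : (3 < 4)%N))).
    + by apply: measurable_funM => //; exact: (measurable_fun_fst mdg).
    + apply: measurable_funM; last exact: measurable_Kn_sub.
      exact: (measurable_fun_fst (measurable_Kn_subr y (isT : (3 < 4)%N))).
  - move=> z.
    by apply: le_normB; apply: le_normM => //; do ?apply: le_normD; do ?apply: le_normM => //;
      rewrite gtr0_norm.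
  - by move=> x y' /g0[gx dgx]; rewrite /q /= gx dgx !(mul0r, mulr0) subrr.
  rewrite /q /=; under eq_Rintegral do rewrite (Rintegral_kernel_pair _ _ dG cdG g0).
  rewrite RintegralD//; last 2 first.
  - by apply: integrable_EFinZ.
  - apply: (@integrable_bounded _ _ _ nu _ (C * Kbound)) => //.
    exact: (measurableT_comp mgK' (measurable_pair1 y)).
  by rewrite RintegralZl// -U3E.
under eq_Rintegral do rewrite FJ.
have iU3 : nu.-integrable setT (EFin \o (fun y => g y * U3 y)).
  apply: (@integrable_bounded _ _ _ nu _ (C * (Kbound * fine (nu setT)))) => //.
    exact: measurable_funM.
  by move=> y; rewrite normrM; apply: ler_pM.
rewrite RintegralD//; last first.
  apply: (@integrable_bounded _ _ _ nu _ (C * Kbound * fine (nu setT))).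
    have := @measurable_fun_Rintegral _ _ _ (measurableTypeR R) (measurableTypeR R) nu
      (fun z => g z.2 * Kn 3 (z.2 - z.1)) (C * Kbound) mgK'.
    by apply => z.
  move=> y; apply: le_norm_Rintegral => //.
  exact: (measurableT_comp mgK' (measurable_pair1 y)).
(* Exchanging [y] and [y'] turns the second family of jumps into the first, which matches the factor
   2. *)
rewrite (@Rfubini _ _ _ _ _ nu nu (fun z => g z.2 * Kn 3 (z.2 - z.1))
  (cst (C * Kbound)))//; last exact: finite_measure_integrable_cst.
rewrite mulr2n mulrDl !mul1r; congr (_ + _).
by apply: eq_Rintegral => y _; rewrite /= RintegralZl// -U3E.
Qed.

End potential.

(** * Smooth functions on the half-plane *)

Section omega.
Context {R : realType}.
Implicit Types (f : R -> R -> R) (g : R -> R).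

Definition smooth_Omega f : Prop := forall n, Ck_Omega n f.

Lemma smooth_Omega_dx f : smooth_Omega f -> smooth_Omega (dx f).
Proof. by move=> sf n; have [_ []] := sf n.+1. Qed.

Lemma smooth_Omega_dt f : smooth_Omega f -> smooth_Omega (dt f).
Proof. by move=> sf n; have [_ []] := sf n.+1. Qed.

Lemma smooth_Omega_is_derive f (x t : R) : smooth_Omega f -> 0 <= t ->
  is_derive x 1 (f^~ t) (dx f x t).
Proof.
move=> sf t0; have [_ [/(_ x t) dF _ _ _]] := sf 1%N.
by apply: derivable_is_derive1; apply: dF; split => //=; rewrite in_itv/= t0.
Qed.

Lemma smooth_Omega_derivable_ge0 f (x t : R) : smooth_Omega f -> 0 <= t ->
  derivable_ge0 (f x) t.
Proof.
move=> sf t0; have [_ [_ /(_ x t) dF _ _]] := sf 1%N.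
by apply: dF; split => //=; rewrite in_itv/= t0.
Qed.

Lemma continuous_max0 : continuous (fun t : R => Num.max t 0).
Proof. by move=> t; apply: continuous_max; [exact: cvg_id|exact: cvg_cst]. Qed.

(* Precomposing with [Num.max t 0] turns one-sided regularity on [0, +oo[ into
   regularity on the whole line. *)
Lemma continuous_within_Rp g :
  (forall t : R, 0 <= t -> g s @[s --> within Rp (nbhs t)] --> g t) ->
  continuous (fun t : R => g (Num.max t 0)).
Proof.
move=> cg t; apply: (@cvg_comp _ _ _ (fun t : R => Num.max t 0) g _
  (within Rp (nbhs (Num.max t 0)))); last by apply: cg; rewrite le_max lexx orbT.
move=> A wA; have : nbhs t (fun s => Rp (Num.max s 0) -> A (Num.max s 0)).
  exact: (@continuous_max0 t _ wA).
apply: filterS => s /=; apply.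
by rewrite in_itv/= andbT le_max lexx orbT.
Qed.

Lemma smooth_Omega_continuous f : smooth_Omega f ->
  continuous (fun p : R * R => f p.1 (Num.max p.2 0)).
Proof.
move=> sf [x t]; have [+ _] := sf 0%N.
pose e (p : R * R) := (p.1, Num.max p.2 0).
have eO p : Omega R (e p).
  by split => //=; rewrite in_itv/= andbT le_max lexx orbT.
have ce : continuous e.
  move=> p.
  have h1 : q.1 @[q --> p] --> p.1 by exact: cvg_fst.
  have h2 : Num.max q.2 0 @[q --> p] --> Num.max p.2 0.
    apply: (@continuous_comp _ _ _ (fun q : R * R => q.2) (fun t : R => Num.max t 0)).
      exact: cvg_snd.
    exact: continuous_max0.
  exact: (cvg_pair h1 h2).
rewrite continuous_subspace_in => /(_ (e (x, t))) H.
have {}H := H (mem_set (eO _)).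
apply: (@cvg_comp _ _ _ e (fun p : R * R => f p.1 p.2) _ (nbhs (e (x, t) : subspace (Omega R)))); last exact: H.
move=> A wA.
have {}wA : within (Omega R) (nbhs (e (x, t))) A.
  by rewrite (nbhs_subspace_in (eO (x, t))).
have : nbhs (x, t) (fun p => Omega R (e p) -> A (e p)) := ce (x, t) _ wA.
by apply: filterS => s /=; apply; exact: eO.
Qed.

(** Every [t >= 0], even 0, is approached from the right inside [Rp]; this makes the filter of
    [derive_ge0] proper and its limits unique. *)
Lemma at_right_within_Rp (t : R) (A : set R) : 0 <= t ->
  within Rp t^' A -> t^'+ A.
Proof.
move=> t0 wA; have H : nbhs t (fun s => s != t -> Rp s -> A s) := wA.
suff : nbhs t (fun s => t < s -> A s) by [].
apply: filterS H => s /= H ts.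
by apply: H; [rewrite gt_eqF|rewrite in_itv/= andbT ltW// (le_lt_trans t0)].
Qed.

Lemma within_Rp_proper (t : R) : 0 <= t -> ProperFilter (within Rp t^').
Proof.
move=> t0; split; last exact: within_filter.
by move=> /(at_right_within_Rp t0); exact: filter_not_empty.
Qed.

Lemma derive_ge0_eq g (t l : R) : 0 <= t ->
  quotient_ge0 g t s @[s --> within Rp t^'] --> l -> derive_ge0 g t = l.
Proof. by move=> /within_Rp_proper pf; exact: cvg_lim. Qed.

Lemma derive_ge0_cvg g (t : R) : derivable_ge0 g t ->
  quotient_ge0 g t s @[s --> within Rp t^'] --> derive_ge0 g t.
Proof. by []. Qed.

Lemma derivable_ge0_continuous g (t : R) : 0 <= t -> derivable_ge0 g t ->
  g s @[s --> within Rp (nbhs t)] --> g t.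
Proof.
move=> t0 dg.
have st : s @[s --> within Rp t^'] --> t.
  move=> A tA; suff : nbhs t (fun s => s != t -> Rp s -> A s) by [].
  by apply: filterS tA => s As _ _.
have H : g s @[s --> within Rp t^'] --> g t.
  rewrite -[X in _ --> X]addr0 -[X in _ + X](mulr0 (derive_ge0 g t)).
  rewrite -[X in _ * X](subrr t).
  apply: (@cvg_trans _ (g t + quotient_ge0 g t s * (s - t) @[s --> within Rp t^'])).
    apply: near_eq_cvg.
    suff : nbhs t (fun s => s != t -> Rp s -> g t + quotient_ge0 g t s * (s - t) = g s).
      by [].
    near=> s => st' _; rewrite /quotient_ge0 divfK ?subr_eq0//.
    by rewrite addrC subrK.
  apply: cvgD; first exact: cvg_cst.
  apply: cvgM; first exact: derive_ge0_cvg.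
  by apply: cvgB; last exact: cvg_cst.
move=> A gA; have HA : nbhs t (fun s => s != t -> Rp s -> A (g s)) := H _ gA.
suff : nbhs t (fun s => Rp s -> A (g s)) by [].
apply: filterS HA => s HA Rs; have [->|st'] := eqVneq s t; last exact: HA.
exact: nbhs_singleton.
Unshelve. all: by end_near. Qed.

Lemma derivable_ge0_is_derive g (t : R) : 0 < t -> derivable_ge0 g t ->
  is_derive t 1 g (derive_ge0 g t).
Proof.
move=> t0 /derive_ge0_cvg dg; apply/is_derive1P => A lA.
have H : nbhs t (fun s => s != t -> Rp s -> A (quotient_ge0 g t s)) := dg _ lA.
have {}H : nbhs t (fun s => s != t -> A (quotient_ge0 g t s)).
  near=> s => st; apply: (near H s) => //.
  rewrite /= in_itv/= andbT ltW//; near: s; exact: lt_nbhsr.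
have c0 : k + t @[k --> (0 : R)] --> t.
  rewrite -[X in _ --> X]add0r; apply: cvgD; [exact: cvg_id|exact: cvg_cst].
have {}H : nbhs (0 : R) (fun k => k + t != t -> A (quotient_ge0 g t (k + t))) := c0 _ H.
suff : nbhs (0 : R) (fun k => k != 0 -> A ((g (k + t) - g t) / k)) by [].
apply: filterS H => k H k0.
have := H; rewrite /quotient_ge0 addrK; apply.
by rewrite -subr_eq0 addrK.
Unshelve. all: by end_near. Qed.

(** The strict inequalities describe a relatively open region, so one [B] serves [f] and all its
    derivatives. *)
Definition supported (B : R) f : Prop :=
  forall x t, 0 <= t -> B < `|x| \/ B < t -> f x t = 0.

Lemma supported_dx B f : supported B f -> supported B (dx f).
Proof.
move=> sf x t t0 [Bx|Bt]; rewrite /dx; last first.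
  rewrite (_ : f^~ t = fun=> 0); last by apply/funext => y; apply: sf => //; right.
  by rewrite derive1_cst.
rewrite -(derive1_cst 0 x) !derive1E; apply: near_eq_derive.
have xn : `|y| @[y --> x] --> `|x| by apply: cvg_norm; exact: cvg_id.
near=> y; apply: sf => //; left.
by near: y; move/cvgr_gt : xn; exact.
Unshelve. all: by end_near. Qed.

Lemma supported_dt B f : supported B f -> supported B (dt f).
Proof.
move=> sf x t t0 Bxt; rewrite /dt; apply: derive_ge0_eq => //.
apply: (@cvg_trans _ (0 @[s --> within Rp t^'])); last exact: cvg_cst.
apply: near_eq_cvg.
have f0 : f x t = 0 by exact: sf.
have : \forall s \near t, B < `|x| \/ B < s.
  case: Bxt => [Bx|Bt]; first by near=> s; left.
  by near=> s; right; near: s; exact: lt_nbhsr.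
rewrite /prop_near1 /within /dnbhs /within /=; apply: filterS => s Bs _ s0.
rewrite /quotient_ge0 f0 sf ?subrr ?mul0r//.
by move: s0; rewrite /= in_itv/= andbT.
Unshelve. all: by end_near. Qed.

Lemma Ccinfty_Omega_supported f : Ccinfty_Omega f -> exists B : R, supported B f.
Proof.
move=> [_ /compact_bounded [C [_ CP]]].
exists (`|C| + 1) => x t t0 Bxt; apply: contrapT => /eqP fxt.
have : `|(x, t)| <= `|C| + 1.
  apply: CP; first by rewrite (le_lt_trans (ler_norm C))// ltrDl.
  by apply: subset_closure; split => //; split => //=; rewrite in_itv/= t0.
rewrite prod_normE/= ge_max => /andP[].
by have := ler_norm t; case: Bxt; lra.
Qed.

Lemma supported_bounded B f : smooth_Omega f -> supported B f ->
  exists C : R, forall x t, 0 <= t -> `|f x t| <= C.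
Proof.
move=> /smooth_Omega_continuous cf sf.
pose A : set (R * R) := `[(- B), B]%classic `*` `[0, B]%classic.
have : compact [set f p.1 (Num.max p.2 0) | p in A].
  apply: continuous_compact; first exact: continuous_subspaceT.
  by apply: compact_setX; exact: segment_compact.
move=> /compact_bounded [C [_ CP]].
exists (`|C| + 1) => x t t0.
have [xB|Bx] := leP `|x| B; last by rewrite sf ?normr0//; left.
have [tB|Bt] := leP t B; last by rewrite sf ?normr0//; right.
apply: CP; first by rewrite (le_lt_trans (ler_norm C))// ltrDl.
exists (x, t); last by rewrite /= max_l.
by split => /=; rewrite in_itv/= ?t0// -ler_norml.
Qed.

Lemma mean_value_between (g dg : R -> R) (a b : R) :
  (forall x : R, is_derive x 1 g (dg x)) ->
  exists xi : R, `|xi - a| <= `|b - a| /\ g b - g a = dg xi * (b - a).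
Proof.
move=> dG.
have cg (A : set R) : {within A, continuous g}.
  apply: continuous_subspaceT => x; exact: is_derive1_continuous (dG x).
have [ab|ba|->] := ltgtP a b; last first.
- by exists b; rewrite !subrr mulr0.
- have [xi] := @MVT _ g dg _ _ ba (fun x _ => dG x) (cg _).
  rewrite in_itv/= => /andP[bx xa] E; exists xi; split.
    by rewrite distrC (distrC b) !ger0_norm; lra.
  by rewrite -[LHS]opprB E -mulrN opprB.
- have [xi] := @MVT _ g dg _ _ ab (fun x _ => dG x) (cg _).
  rewrite in_itv/= => /andP[ax xb] E; exists xi; split=> //.
  by rewrite !ger0_norm; lra.
Qed.

(** Only partial derivatives are given. The increment in [x] is taken at the displaced time, where
    the mean value theorem supplies [xi], and the increment in time at the fixed point [gam t];
    joint continuity of [dx f] then gives the limit. *)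
Lemma smooth_Omega_chain_rule f (gam : R -> R) (t dgam : R) :
  smooth_Omega f -> 0 < t -> is_derive t 1 gam dgam ->
  is_derive t 1 (fun s => f (gam s) (Num.max s 0))
    (dx f (gam t) t * dgam + dt f (gam t) t).
Proof.
move=> sf t0 dgam_.
have tE : Num.max t 0 = t by rewrite max_l// ltW.
have max_ge0 (s : R) : 0 <= Num.max s 0 by rewrite le_max lexx orbT.
have /choice[xi xiP] : forall k : R, exists xi : R,
    `|xi - gam t| <= `|gam (k + t) - gam t| /\
    f (gam (k + t)) (Num.max (k + t) 0) - f (gam t) (Num.max (k + t) 0) =
    dx f xi (Num.max (k + t) 0) * (gam (k + t) - gam t).
  move=> k; apply: (mean_value_between (g := f^~ (Num.max (k + t) 0))
    (dg := fun x => dx f x (Num.max (k + t) 0))) => x.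
  exact: smooth_Omega_is_derive.
have cgam : {for t, continuous gam} by exact: is_derive1_continuous dgam_.
have kt : k + t @[k --> (0 : R)^'] --> t.
  rewrite -[X in _ --> X]add0r; apply: cvgD; last exact: cvg_cst.
  exact: cvg_within.
have gkt : gam (k + t) @[k --> (0 : R)^'] --> gam t.
  exact: (cvg_comp _ _ kt cgam).
have cxi : xi k @[k --> (0 : R)^'] --> gam t.
  apply/cvgrPdist_le => e e0.
  move/cvgrPdist_le : gkt => /(_ _ e0); apply: filterS => k ke.
  by rewrite distrC (le_trans (xiP k).1)// distrC.
have cdx : dx f (xi k) (Num.max (k + t) 0) @[k --> (0 : R)^'] --> dx f (gam t) t.
  have := smooth_Omega_continuous (smooth_Omega_dx sf) => /(_ (gam t, t)).
  rewrite /continuous_at /= tE => H.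
  exact: (cvg_comp _ _ (cvg_pair cxi kt) H).
have dft : is_derive t 1 (fun s => f (gam t) (Num.max s 0)) (dt f (gam t) t).
  apply: (@near_eq_is_derive _ _ _ (f (gam t))).
    near=> s; rewrite max_l//; apply: ltW; near: s; exact: lt_nbhsr.
  apply: (derivable_ge0_is_derive t0).
  exact: smooth_Omega_derivable_ge0 sf (ltW t0).
apply/is_derive1P.
have -> : (fun k => (f (gam (k + t)) (Num.max (k + t) 0) -
    f (gam t) (Num.max t 0)) / k) = (fun k =>
    dx f (xi k) (Num.max (k + t) 0) * ((gam (k + t) - gam t) / k) +
    (f (gam t) (Num.max (k + t) 0) - f (gam t) (Num.max t 0)) / k).
  by apply/funext => k; rewrite mulrA -(xiP k).2 -mulrDl addrA subrK.
by apply: cvgD; [apply: cvgM => //|]; exact/is_derive1P.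
Unshelve. all: by end_near. Qed.

End omega.

(** * Supports of measures *)

Section support.
Context {R : realType}.

(** Each point off the support lies in a null interval with rational endpoints, and there are
    countably many of these; [F] enumerates them through [unpickle]. *)
Lemma negligible_setC_msupp (mu : {measure set (measurableTypeR R) -> \bar R}) :
  mu.-negligible (~` msupp mu).
Proof.
pose I (pq : rat * rat) : set (measurableTypeR R) := `]ratr pq.1, ratr pq.2[%classic.
pose F (n : nat) : set (measurableTypeR R) :=
  if (unpickle n : option (rat * rat)) is Some pq then
    if mu (I pq) == 0%E then I pq else set0 else set0.
apply: (@negligibleS _ _ _ mu (\bigcup_k F k)); last first.
  apply: negligible_bigcup => k; rewrite /F.
  case: (unpickle k) => [pq|]; last exact: negligible_set0.
  case: ifPn => [/eqP m0|_]; last exact: negligible_set0.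
  by exists (I pq); split; [exact: measurable_itv|exact: m0|exact: subset_refl].
move=> z /existsNP [U /not_implyP[oU /not_implyP[Uz /negP]]].
rewrite -leNgt measure_le0 => /eqP muU.
have /nbhs_ballP[e /= e0 eU] : nbhs z U by exact: open_nbhs_nbhs.
have [p] : exists q : rat, ratr q \in `]z - e, z[ by apply: rat_in_itvoo; rewrite ltrBlDl ltrDr.
have [q] : exists q : rat, ratr q \in `]z, z + e[ by apply: rat_in_itvoo; rewrite ltrDl.
rewrite !in_itv/= => /andP[zq qz] /andP[pz zp].
have muI : mu (I (p, q)) = 0%E.
  apply/eqP; rewrite -measure_le0 -muU; apply: le_measure; rewrite ?inE.
  - exact: measurable_itv.
  - exact: open_measurable.
  - move=> x; rewrite /I /= in_itv/= => /andP[px xq]; apply: eU.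
    by rewrite /ball/= ltr_norml; lra.
have FI : F (pickle (p, q)) = I (p, q) by rewrite /F pickleK muI eqxx.
exists (pickle (p, q)); first exact: Logic.I.
by rewrite FI /I /= in_itv/= zp zq.
Qed.

End support.

(** The derivative is asked only at positive times; continuity of [E] covers the endpoint 0. As
    [E T = 0], the integral of the derivative is [- E 0]. *)
Lemma FTC_linear_combination (R : realType) (E j0 j1 j2 j3 j4 : R -> R)
    (k2 k3 k4 T : R) : 0 < T ->
  continuous j0 -> continuous j1 -> continuous j2 -> continuous j3 -> continuous j4 ->
  continuous E ->
  (forall t : R, 0 < t -> is_derive t 1 E
     (j0 t + j1 t - k2 * j2 t - k3 * j3 t - k4 * j4 t)) ->
  E T = 0 ->
  E 0 + \int[lebesgue_measure]_(t in `[0, T]) j0 t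
    + \int[lebesgue_measure]_(t in `[0, T]) j1 t
    - k2 * \int[lebesgue_measure]_(t in `[0, T]) j2 t
    - k3 * \int[lebesgue_measure]_(t in `[0, T]) j3 t
    - k4 * \int[lebesgue_measure]_(t in `[0, T]) j4 t = 0.
Proof.
move=> T0 c0 c1 c2 c3 c4 cE dE ET.
pose S t := j0 t + j1 t + - k2 * j2 t + - k3 * j3 t + - k4 * j4 t.
have SE t : S t = j0 t + j1 t - k2 * j2 t - k3 * j3 t - k4 * j4 t by rewrite /S; ring.
have cS : continuous S.
  move=> t; apply: cvgD; last by apply: cvgMr; exact: c4.
  apply: cvgD; last by apply: cvgMr; exact: c3.
  apply: cvgD; last by apply: cvgMr; exact: c2.
  by apply: cvgD; [exact: c0|exact: c1].
have FTC : \int[lebesgue_measure]_(t in `[0, T]) S t = - E 0.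
  rewrite /Rintegral (@continuous_FTC2 _ S E)//=.
  - by rewrite ET sub0r.
  - exact: continuous_subspaceT.
  - split.
    + by move=> t; rewrite in_itv/= => /andP[t0 _]; have := dE t t0 => ?; apply: ex_derive.
    + by apply: cvg_at_right_filter; exact: cE.
    + by apply: cvg_at_left_filter; exact: cE.
  - by move=> t; rewrite in_itv/= => /andP[t0 _]; rewrite SE; exact: is_derive1E (dE t t0).
have mT : measurable (`[0, T]%classic : set (measurableTypeR R)) by exact: measurable_itv.
have icont (g : R -> R) : continuous g ->
    lebesgue_measure.-integrable `[0, T] (EFin \o g).
  move=> cg; apply: continuous_compact_integrable; first exact: segment_compact.
  exact: continuous_subspaceT.
have iZ (k : R) (g : R -> R) : continuous g ->
    lebesgue_measure.-integrable `[0, T] (EFin \o (fun t => k * g t)).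
  by move=> cg; exact: (integrableZl mT k (icont _ cg)).
have iD (g g' : R -> R) : lebesgue_measure.-integrable `[0, T] (EFin \o g) ->
    lebesgue_measure.-integrable `[0, T] (EFin \o g') ->
    lebesgue_measure.-integrable `[0, T] (EFin \o (fun t => g t + g' t)).
  by move=> ig ig'; exact: (integrableD mT ig ig').
have [i0 i1] := conj (icont _ c0) (icont _ c1).
have [k2i k3i k4i] := And3 (iZ (- k2) _ c2) (iZ (- k3) _ c3) (iZ (- k4) _ c4).
have l1 := iD _ _ i0 i1; have l2 := iD _ _ l1 k2i; have l3 := iD _ _ l2 k3i.
move: FTC; rewrite /S (RintegralD mT l3 k4i) (RintegralD mT l2 k3i).
rewrite (RintegralD mT l1 k2i) (RintegralD mT i0 i1).
rewrite (RintegralZl _ mT (icont _ c2)) (RintegralZl _ mT (icont _ c3)).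
rewrite (RintegralZl _ mT (icont _ c4)) => FTC.
by rewrite -[E 0]opprK -FTC; ring.
Qed.

Lemma smooth_Omega_continuous_along (R : realType) (f : R -> R -> R) (a : R -> R)
    (t : R) : smooth_Omega f -> {for t, continuous a} ->
  {for t, continuous (fun s => f (a s) (Num.max s 0))}.
Proof.
move=> sf ca; have H := smooth_Omega_continuous sf (x := (a t, t)).
exact: (cvg_comp _ _ (cvg_pair ca (@cvg_id _ (nbhs t))) H).
Qed.

(** * The transported measure *)

Section transported_measure.
Context {R : realType} (alpha : R).
Hypothesis alpha_gt0 : 0 < alpha.
Variables (mu : {finite_measure set (measurableTypeR R) -> \bar R}).
Variables (C : R -> R -> R)
  (nu : R -> {finite_measure set (measurableTypeR R) -> \bar R}).
Hypothesis mC : forall t, measurable_fun setT (C^~ t : measurableTypeR R -> measurableTypeR R).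
Hypothesis cC : forall z, continuous (C z).
Hypothesis nuE : forall t (A : set (measurableTypeR R)), measurable A ->
  nu t A = mu ((C^~ t) @^-1` A).
Local Notation leb := (@lebesgue_measure R).
Local Notation Kn := (Kn alpha).
Local Notation Kbound := (Kbound alpha).
Definition transported_potential (n : nat) (x t : R) : R := potential alpha (nu t) n x.
Local Notation W := transported_potential.

Lemma Rintegral_transported t (f : R -> R) (B : R) : measurable_fun setT f ->
  (forall x, `|f x| <= B) -> \int[nu t]_y f y = \int[mu]_z f (C z t).
Proof.
move=> mf fB; rewrite /Rintegral; congr fine.
have mfC : measurable_fun setT (fun z : measurableTypeR R => f (C z t)).
  exact: (measurableT_comp mf (mC t)).
transitivity (\int[pushforward mu (C^~ t : measurableTypeR R -> measurableTypeR R)]_y (f y)%:E)%E.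
  apply: (@eq_measure_integral _ _ _ _
    (measure_function_pushforward__canonical__measure_function_Measure mu (mC t))).
  by move=> A mA _; rewrite /= nuE.
rewrite integral_pushforward//.
- exact/measurable_EFinP.
- by rewrite preimage_setT; exact: (@integrable_bounded _ _ _ mu _ B).
Qed.

Lemma transported_setT t : nu t setT = mu setT.
Proof. by rewrite nuE// preimage_setT. Qed.

Lemma potential_transported n x t : (n < 4)%N ->
  W n x t = \int[mu]_z Kn n (x - C z t).
Proof.
move=> n4; apply: (@Rintegral_transported _ (fun y => Kn n (x - y)) Kbound).
  exact: measurable_Kn_subl.
by move=> y; exact: Kn_bound.
Qed.

(** [Kn 3] is discontinuous at 0 only, so the bad labels are those located at [x] at time [t0];
    their [mu]-measure is [nu t0 [set x]]. *)
Lemma continuous_at_potential_transported n (x t0 : R) : (n < 4)%N ->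
  (n < 3)%N \/ nu t0 [set x] = 0%E -> {for t0, continuous (W n x)}.
Proof.
move=> n4 Hn.
have -> : W n x = fun t => \int[mu]_z Kn n (x - C z t).
  by apply/funext => t; rewrite potential_transported.
apply: (@continuous_at_Rintegral _ _ _ mu (fun t z => Kn n (x - C z t)) (cst Kbound)).
- by move=> t; have := measurableT_comp (measurable_Kn_subl alpha x n4) (mC t).
- exact: finite_measure_integrable_cst.
- by move=> t z; exact: Kn_bound.
- have cx z : {for t0, continuous (fun t => x - C z t)}.
    by apply: cvgB; [exact: cvg_cst|exact: cC].
  case: Hn => [n3|nux].
    apply: aeW => z; apply: (@continuous_comp _ _ _ (fun t => x - C z t) (Kn n)) => //.
    exact: continuous_Kn.
  exists ((C^~ t0) @^-1` [set x]); split.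
  + by rewrite -[X in measurable X]setTI; apply: mC => //; exact: measurable_set1.
  + by rewrite -nux; apply/esym/nuE; exact: measurable_set1.
  + move=> z /= ncont; apply: contrapT => Czx; apply: ncont.
    apply: (@continuous_comp _ _ _ (fun t => x - C z t) (Kn n)) => //.
    have [n3|n3] := ltnP n 3; first exact: continuous_Kn.
    have -> : n = 3%N by lia.
    by apply: continuous_Kn3 => //; rewrite subr_eq0; apply/eqP => /esym.
Qed.

(* The coefficients of the weak formulation have jumps in [x], so they are
   continuous in time only at almost every [x]. *)
Definition ae_continuous_in_time (G : R -> R -> R) : Prop :=
  [/\ forall t, measurable_fun setT (G^~ t : measurableTypeR R -> R),
      exists A : R, forall x t, `|G x t| <= A &
      forall t0 : R, {ae leb, forall x, {for t0, continuous (G x)}}].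

Lemma ae_continuous_in_timeM (G G' : R -> R -> R) :
  ae_continuous_in_time G -> ae_continuous_in_time G' ->
  ae_continuous_in_time (fun x t => G x t * G' x t).
Proof.
move=> [mG [A GA] cG] [mG' [A' GA'] cG']; split.
- by move=> t; exact: measurable_funM.
- by exists (A * A') => x t; exact: le_normM.
- move=> t0; apply: (@filterS2 _ _ (ae_filter_ringOfSetsType leb)) (cG t0) (cG' t0) => x cGx cG'x.
  exact: cvgM.
Qed.

(** The exceptional [x] are atoms of [nu t0], hence Lebesgue-null. The bound is uniform in time
    because the total mass is conserved. *)
Lemma ae_continuous_in_time_potential n : (n < 4)%N -> ae_continuous_in_time (W n).
Proof.
move=> n4; split.
- by move=> t; exact: measurable_potential.
- exists (Kbound * fine (mu setT)) => x t; rewrite -(transported_setT t).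
  exact: potential_bound.
- move=> t0; apply: (@filterS _ _ (ae_filter_ringOfSetsType leb)) (ae_measure_set1_eq0 (nu t0)) => x nux.
  by apply: continuous_at_potential_transported => //; right.
Qed.

Lemma integrable_ae_continuous_in_time G f B (t : R) : ae_continuous_in_time G ->
  smooth_Omega f -> supported B f -> 0 <= t ->
  leb.-integrable setT (EFin \o (fun x => G x t * f x t)).
Proof.
move=> [mG [A GA] cG] sf Bf t0; have [D fD] := supported_bounded sf Bf.
apply: (@integrable_compact_support _ _ (A * D) B).
- apply: measurable_funM; first exact: mG.
  apply: measurable_fun_continuous => x.
  exact: is_derive1_continuous (smooth_Omega_is_derive x sf t0).
- by move=> x; apply: le_normM => //; exact: fD.
- by move=> x Bx; rewrite (Bf x t)// ?mulr0//; left.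
Qed.

Lemma continuous_ae_continuous_in_time G f B : ae_continuous_in_time G ->
  smooth_Omega f -> supported B f ->
  continuous (fun t => \int[leb]_x (G x t * f x (Num.max t 0))).
Proof.
move=> [mG [A GA] cG] sf Bf t0; have [D fD] := supported_bounded sf Bf.
have max_ge0 (s : R) : 0 <= Num.max s 0 by rewrite le_max lexx orbT.
apply: (@continuous_at_Rintegral _ _ _ leb (fun t x => G x t * f x (Num.max t 0))
  (fun x => A * D * \1_`[(- B), B] x)).
- move=> t; apply: measurable_funM; first exact: mG.
  apply: measurable_fun_continuous => x.
  exact: is_derive1_continuous (smooth_Omega_is_derive x sf (max_ge0 t)).
- by apply: integrable_EFinZ; exact: integrable_indic_itv.
- move=> t x; rewrite indicE; case: (boolP (x \in _)) => [_|].
    by rewrite mulr1; apply: le_normM => //; exact: fD.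
  rewrite mem_setE in_itv/= -ler_norml -ltNge => Bx.
  by rewrite (Bf x _ (max_ge0 t))//; [rewrite !mulr0 normr0|left].
- apply: (@filterS _ _ (ae_filter_ringOfSetsType leb)) (cG t0) => x cGx; apply: cvgM => //.
  by apply: smooth_Omega_continuous_along => //; exact: cvg_cst.
Qed.

Variable M : set (measurableTypeR R).
Hypothesis mM : measurable M.
Hypothesis muM : mu (~` M) = 0%E.
Hypothesis dC : forall z t : R, M z -> 0 < t ->
  is_derive t 1 (C z) (W 0 (C z t) t ^+ 2 * W 3 (C z t) t).

Lemma Rintegral_carrier (f : R -> R) (A : R) : measurable_fun setT f ->
  (forall x, `|f x| <= A) -> \int[mu]_(z in M) f z = \int[mu]_z f z.
Proof.
move=> mf fA; rewrite /Rintegral; congr fine; apply/esym.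
rewrite (@negligible_integral _ _ _ mu setT (~` M))//.
- by rewrite setTD setCK.
- exact: measurableC.
- exact: (@integrable_bounded _ _ _ mu _ A).
Qed.

Lemma measurable_smooth_Omega_along f t : smooth_Omega f -> 0 <= t ->
  measurable_fun setT (fun z : measurableTypeR R => f (C z t) t).
Proof.
move=> sf t0.
have mf : measurable_fun setT (f^~ t).
  apply: measurable_fun_continuous => x.
  exact: is_derive1_continuous (smooth_Omega_is_derive x sf t0).
by have := measurableT_comp mf (mC t).
Qed.

Let max_ge0 (s : R) : 0 <= Num.max s 0. Proof. by rewrite le_max lexx orbT. Qed.

(** The pairing of [f] with the measure at time [t], written over the labels so that it can be
    differentiated along the trajectories. *)
Definition transported_integral f t : R := \int[mu]_z f (C z t) (Num.max t 0).

Lemma continuous_transported_integral f B : smooth_Omega f -> supported B f ->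
  continuous (transported_integral f).
Proof.
move=> sf Bf t0; have [D fD] := supported_bounded sf Bf.
apply: (@continuous_at_Rintegral _ _ _ mu (fun t z => f (C z t) (Num.max t 0)) (cst D)).
- move=> t.
  have mf : measurable_fun setT (f^~ (Num.max t 0)).
    apply: measurable_fun_continuous => x.
    exact: is_derive1_continuous (smooth_Omega_is_derive x sf (max_ge0 t)).
  by have := measurableT_comp mf (mC t).
- exact: finite_measure_integrable_cst.
- by move=> t z; exact: fD.
- by apply: aeW => z; apply: smooth_Omega_continuous_along => //; exact: cC.
Qed.

Lemma transported_integral_carrier f B t : smooth_Omega f -> supported B f ->
  transported_integral f t = \int[mu]_(z in M) f (C z t) (Num.max t 0).
Proof.
move=> sf Bf; have [D fD] := supported_bounded sf Bf.
apply/esym; apply: (@Rintegral_carrier _ D); last by move=> z; exact: fD.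
have mf : measurable_fun setT (f^~ (Num.max t 0)).
  apply: measurable_fun_continuous => x.
  exact: is_derive1_continuous (smooth_Omega_is_derive x sf (max_ge0 t)).
by have := measurableT_comp mf (mC t).
Qed.

(** Differentiation under the integral is done over [M], where the ODE is available, then brought
    back to the whole line. Mass conservation bounds the velocities uniformly, which yields the
    constant dominating function. *)
Lemma is_derive_transported_integral f B (t : R) : smooth_Omega f -> supported B f -> 0 < t ->
  is_derive t 1 (transported_integral f) (\int[mu]_z (dx f (C z t) t *
    (W 0 (C z t) t ^+ 2 * W 3 (C z t) t)) + transported_integral (dt f) t).
Proof.
move=> sf Bf t0.
have [sdx sdt] := (smooth_Omega_dx sf, smooth_Omega_dt sf).
have [Bdx Bdt] := (supported_dx Bf, supported_dt Bf).
have [D fD] := supported_bounded sf Bf.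
have [Dx dxD] := supported_bounded sdx Bdx.
have [Dt dtD] := supported_bounded sdt Bdt.
pose UB := Kbound * fine (mu setT).
have Wb n x s : (n < 4)%N -> `|W n x s| <= UB.
  by move=> n4; rewrite /UB -(transported_setT s); exact: potential_bound.
pose F s z := f (C z s) (Num.max s 0).
pose dF s z := dx f (C z s) s * (W 0 (C z s) s ^+ 2 * W 3 (C z s) s) + dt f (C z s) s.
have dFP (s z : R) : 0 < s -> M z -> is_derive s 1 (F^~ z) (dF s z).
  by move=> s0 Mz; apply: smooth_Omega_chain_rule => //; exact: dC.
(* The interval stays away from time 0, where no derivative of [C] is given. *)
have tI : `]0, t + 1[%classic t by rewrite /= in_itv/= t0 ltrDl ltr01.
have H1 : forall s : R, `]0, t + 1[%classic s -> mu.-integrable M (EFin \o F s).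
  move=> s _; apply: (integrableS measurableT) => //.
  apply: (@integrable_bounded _ _ _ mu _ D); last by move=> z; exact: fD.
  have mf : measurable_fun setT (f^~ (Num.max s 0)).
    apply: measurable_fun_continuous => x.
    exact: is_derive1_continuous (smooth_Omega_is_derive x sf (max_ge0 s)).
  by have := measurableT_comp mf (mC s).
have H2 : forall (s : R) z, `]0, t + 1[%classic s -> M z -> derivable (F^~ z) s 1.
  move=> s z; rewrite /= in_itv/= => /andP[s0 _] Mz.
  by have := dFP s z s0 Mz => ?; apply: ex_derive.
pose G := Dx * (UB ^+ 2 * UB) + Dt.
have G0 : 0 <= G.
  have UB0 : 0 <= UB by exact: le_trans (normr_ge0 _) (Wb 0%N 0 0 isT).
  have Dx0 : 0 <= Dx by exact: le_trans (normr_ge0 _) (dxD 0 0 (lexx _)).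
  have Dt0 : 0 <= Dt by exact: le_trans (normr_ge0 _) (dtD 0 0 (lexx _)).
  by apply: addr_ge0 => //; apply: mulr_ge0 => //; apply: mulr_ge0 => //; exact: exprn_ge0.
have H3 (y : measurableTypeR R) : 0 <= cst G y by [].
have H4 : mu.-integrable M (EFin \o cst G).
  by apply: (integrableS measurableT) => //; exact: finite_measure_integrable_cst.
have H5 : forall s z, `]0, t + 1[%classic s -> M z ->
    `|partial1of2 F s z| <= cst G z.
  move=> s z; rewrite /= in_itv/= => /andP[s0 _] Mz.
  rewrite /partial1of2 (is_derive1E (dFP s z s0 Mz)).
  apply: le_normD; last exact/dtD/ltW.
  apply: le_normM; first exact/dxD/ltW.
  by apply: le_normM; [apply: le_normX2|]; exact: Wb.
have := derivable_under_integral mM tI H1 H2 H3 H4 H5 => /derivable_is_derive1.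
rewrite (differentiation_under_integral mM tI H1 H2 H3 H4 H5).
rewrite (_ : (fun s => \int[mu]_(z in M) F s z) = transported_integral f); last first.
  by apply/funext => s; rewrite (transported_integral_carrier _ sf Bf).
have -> : \int[mu]_(z in M) partial1of2 F t z = \int[mu]_(z in M) dF t z.
  apply: eq_Rintegral => z; rewrite inE => Mz.
  by rewrite /partial1of2 (is_derive1E (dFP t z t0 Mz)).
have tE : Num.max t 0 = t by rewrite max_l// ltW.
have mdx : measurable_fun setT (fun z : measurableTypeR R =>
    dx f (C z t) t * (W 0 (C z t) t ^+ 2 * W 3 (C z t) t)).
  have mW n : (n < 4)%N -> measurable_fun setT (fun z : measurableTypeR R => W n (C z t) t).
    move=> n4; have mWn : measurable_fun setT (W n ^~ t) by exact: measurable_potential.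
    by have := measurableT_comp mWn (mC t).
  apply: measurable_funM; first exact: (measurable_smooth_Omega_along sdx (ltW t0)).
  by apply: measurable_funM; [apply: measurable_funX|]; exact: mW.
have bdx z : `|dx f (C z t) t * (W 0 (C z t) t ^+ 2 * W 3 (C z t) t)| <=
    Dx * (UB ^+ 2 * UB).
  apply: le_normM; first exact/dxD/ltW.
  by apply: le_normM; [apply: le_normX2|]; exact: Wb.
have mdt := measurable_smooth_Omega_along sdt (ltW t0).
have bdt z : `|dt f (C z t) t| <= Dt by exact/dtD/ltW.
rewrite (@Rintegral_carrier _ G) ; last 2 first.
- exact: measurable_funD.
- by move=> z; apply: le_normD.
have idx := integrable_bounded mu mdx bdx.
have idt := integrable_bounded mu mdt bdt.
have -> : \int[mu]_z dF t z = \int[mu]_z (dx f (C z t) t *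
    (W 0 (C z t) t ^+ 2 * W 3 (C z t) t)) + \int[mu]_z dt f (C z t) t.
  exact: (RintegralD measurableT idx idt).
by rewrite /transported_integral tE.
Qed.

Lemma supported_iter_dx n f B : supported B f -> supported B (iter n (@dx R) f).
Proof. by move=> Bf; elim: n => //= n; exact: supported_dx. Qed.

Lemma smooth_Omega_iter_dx n f : smooth_Omega f -> smooth_Omega (iter n (@dx R) f).
Proof. by move=> sf; elim: n => //= n; exact: smooth_Omega_dx. Qed.

Lemma helmholtz2E f (x t : R) : smooth_Omega f -> 0 <= t ->
  helmholtz alpha (helmholtz alpha f) x t =
  f x t - 2 * alpha ^+ 2 * iter 2 (@dx R) f x t + alpha ^+ 4 * iter 4 (@dx R) f x t.
Proof.
move=> sf t0.
(* An opaque name for the iterated derivatives keeps them folded during the computation. *)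
have [D DE] : exists D : nat -> R -> R, D = fun n y => iter n (@dx R) f y t by eexists.
have d n (y : R) : is_derive y 1 (D n) (D n.+1 y).
  by rewrite DE; exact: smooth_Omega_is_derive (smooth_Omega_iter_dx n sf) t0.
have h0 : (helmholtz alpha f)^~ t = fun y => D 0%N y - alpha ^+ 2 * D 2%N y by rewrite DE.
have h1 : (dx (helmholtz alpha f))^~ t = fun y => D 1%N y - alpha ^+ 2 * D 3%N y.
  apply/funext => y; rewrite /dx h0.
  have d02 : is_derive y 1 (fun y => D 0%N y - alpha ^+ 2 * D 2%N y)
      (D 1%N y - alpha ^+ 2 * D 3%N y).
    by have d0 := d 0%N y; have d2 := d 2%N y; derive1_auto; ring.
  exact: is_derive1E d02.
pose D' n y := iter n (@dx R) f y t.
change (helmholtz alpha f x t - alpha ^+ 2 * derive1 ((dx (helmholtz alpha f))^~ t) x =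
  D' 0%N x - 2 * alpha ^+ 2 * D' 2%N x + alpha ^+ 4 * D' 4%N x).
have d13 : is_derive x 1 (fun y => D 1%N y - alpha ^+ 2 * D 3%N y)
    (D 2%N x - alpha ^+ 2 * D 4%N x).
  by have d1 := d 1%N x; have d3 := d 3%N x; derive1_auto; ring.
rewrite h1 (is_derive1E d13).
have -> : helmholtz alpha f x t = D 0%N x - alpha ^+ 2 * D 2%N x.
  by rewrite -[RHS]/((fun y => D 0%N y - alpha ^+ 2 * D 2%N y) x) -h0.
by rewrite -[D']DE; ring.
Qed.

Lemma transported_integral_green f B (t : R) : smooth_Omega f -> supported B f -> 0 <= t ->
  transported_integral f t =
  \int[leb]_x (W 0 x t * helmholtz alpha (helmholtz alpha f) x t).
Proof.
move=> sf Bf t0; have [D fD] := supported_bounded sf Bf.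
under eq_Rintegral do rewrite (helmholtz2E _ sf t0).
have tE : Num.max t 0 = t by rewrite max_l.
have dth n (x : R) : is_derive x 1 ((iter n (@dx R) f)^~ t) (iter n.+1 (@dx R) f x t).
  exact: smooth_Omega_is_derive (smooth_Omega_iter_dx n sf) t0.
have th0 n x : B < `|x| -> iter n (@dx R) f x t = 0.
  by move=> Bx; apply: (supported_iter_dx n Bf) => //; left.
have G := @Rintegral_potential_green _ _ alpha_gt0 (nu t)
  (fun n x => iter n (@dx R) f x t) B dth th0.
transitivity (\int[nu t]_y f y t); last exact: esym G.
rewrite (@Rintegral_transported t (f^~ t) D).
- by rewrite /transported_integral tE.
- apply: measurable_fun_continuous => x.
  exact: is_derive1_continuous (smooth_Omega_is_derive x sf t0).
- by move=> x; exact: fD.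
Qed.

Let aW n : (n < 4)%N -> ae_continuous_in_time (W n).
Proof. exact: ae_continuous_in_time_potential. Qed.

Lemma ae_continuous_in_time_fluxes :
  [/\ ae_continuous_in_time (fun x t => W 0 x t ^+ 3 * W 3 x t),
      ae_continuous_in_time (fun x t => W 0 x t ^+ 2 * W 2 x t * W 3 x t),
      ae_continuous_in_time (fun x t => W 0 x t * W 1 x t * W 3 x t ^+ 2) &
      ae_continuous_in_time (fun x t => (W 0 x t * W 3 x t) ^+ 2)].
Proof.
have aM := ae_continuous_in_timeM.
have [a0 a1 a2 a3] := And4 (@aW 0 isT) (@aW 1 isT) (@aW 2 isT) (@aW 3 isT).
split.
- exact: (aM _ _ (aM _ _ a0 (aM _ _ a0 a0)) a3).
- exact: (aM _ _ (aM _ _ (aM _ _ a0 a0) a2) a3).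
- exact: (aM _ _ (aM _ _ a0 a1) (aM _ _ a3 a3)).
- exact: (aM _ _ (aM _ _ a0 a3) (aM _ _ a0 a3)).
Qed.

(** The cubic identity is used with [g] equal to [f u^2]. Half of [g' = f_x u^2 + 2 f u u_x]
    separates into the last two terms: the factor [2^-1] stays on the term in [f_x] and cancels on
    the one in [u u_x]. *)
Lemma flux_identity f B (t : R) : smooth_Omega f -> supported B f -> 0 <= t ->
  \int[mu]_z (f (C z t) t * (W 0 (C z t) t ^+ 2 * W 3 (C z t) t)) =
  \int[leb]_x (W 0 x t ^+ 3 * W 3 x t * f x t)
  - 2 * alpha ^+ 2 * \int[leb]_x (W 0 x t ^+ 2 * W 2 x t * W 3 x t * f x t)
  - alpha ^+ 4 * \int[leb]_x (W 0 x t * W 1 x t * W 3 x t ^+ 2 * f x t)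
  - 2^-1 * alpha ^+ 4 * \int[leb]_x ((W 0 x t * W 3 x t) ^+ 2 * dx f x t).
Proof.
move=> sf Bf t0; have [D fD] := supported_bounded sf Bf.
have [sdf Bdf] := (smooth_Omega_dx sf, supported_dx Bf).
have [c1 c2 c3 c4] := ae_continuous_in_time_fluxes.
have i1 := integrable_ae_continuous_in_time c1 sf Bf t0.
have i2 := integrable_ae_continuous_in_time c2 sf Bf t0.
have i3 := integrable_ae_continuous_in_time c3 sf Bf t0.
have i4 := integrable_ae_continuous_in_time c4 sdf Bdf t0.
pose g x := f x t * W 0 x t ^+ 2.
pose dg x := dx f x t * W 0 x t ^+ 2 + 2 * f x t * W 0 x t * W 1 x t.
have df (x : R) : is_derive x 1 (f^~ t) (dx f x t) by exact: smooth_Omega_is_derive.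
have dW0 (x : R) : is_derive x 1 ((W 0)^~ t) (W 1 x t) by exact: is_derive_potential.
have cf : continuous (f^~ t) by move=> x; exact: is_derive1_continuous (df x).
have cdf : continuous ((dx f)^~ t).
  by move=> x; exact: is_derive1_continuous (smooth_Omega_is_derive x sdf t0).
have cW n : (n < 3)%N -> continuous ((W n)^~ t) by move=> n3; exact: continuous_potential.
have dG (x : R) : is_derive x 1 g (dg x).
  have := df x; have := dW0 x => ? ?.
  rewrite (_ : g = fun x => f x t * (W 0 x t * W 0 x t)) //.
  by derive1_auto; rewrite /dg; ring.
have cdg : continuous dg.
  move=> x; apply: cvgD; apply: cvgM; last exact: cW.
  - exact: cdf.
  - by apply: (@cvgM _ _ _ _ ((W 0)^~ t) ((W 0)^~ t)); exact: cW.
  - by apply: cvgM; [apply: cvgMr; exact: cf|exact: cW].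
have g0 x : B < `|x| -> g x = 0 /\ dg x = 0.
  move=> Bx; have fx : f x t = 0 by apply: Bf => //; left.
  have dfx : dx f x t = 0 by apply: Bdf => //; left.
  by rewrite /g /dg fx dfx !(mul0r, mulr0) addr0.
pose UB := Kbound * fine (nu t setT).
have Wb n x : (n < 4)%N -> `|W n x t| <= UB by move=> n4; exact: potential_bound.
have mW3 : measurable_fun setT ((W 3)^~ t) by exact: measurable_potential.
have := Rintegral_potential_cubic alpha_gt0 (nu t) dG cdg g0.
rewrite (@Rintegral_transported t _ (D * UB ^+ 2 * UB)); last 2 first.
- apply: measurable_funM => //; apply: measurable_fun_continuous => x.
  exact: is_derive1_continuous (dG x).
- move=> x; apply: le_normM; last exact: Wb.
  by apply: le_normM; [exact: fD|apply: le_normX2; exact: Wb].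
move=> H; transitivity (\int[mu]_z (g (C z t) * potential alpha (nu t) 3 (C z t))).
  by apply: eq_Rintegral => z _; rewrite /g mulrA.
rewrite -H.
have E : \int[leb]_x (W 0 x t ^+ 3 * W 3 x t * f x t +
    (- (2 * alpha ^+ 2)) * (W 0 x t ^+ 2 * W 2 x t * W 3 x t * f x t) +
    (- alpha ^+ 4) * (W 0 x t * W 1 x t * W 3 x t ^+ 2 * f x t) +
    (- (2^-1 * alpha ^+ 4)) * ((W 0 x t * W 3 x t) ^+ 2 * dx f x t)) =
  \int[leb]_x (W 0 x t ^+ 3 * W 3 x t * f x t)
  - 2 * alpha ^+ 2 * \int[leb]_x (W 0 x t ^+ 2 * W 2 x t * W 3 x t * f x t)
  - alpha ^+ 4 * \int[leb]_x (W 0 x t * W 1 x t * W 3 x t ^+ 2 * f x t)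
  - 2^-1 * alpha ^+ 4 * \int[leb]_x ((W 0 x t * W 3 x t) ^+ 2 * dx f x t).
  have j2 := integrable_EFinZ (- (2 * alpha ^+ 2)) i2.
  have j3 := integrable_EFinZ (- alpha ^+ 4) i3.
  have j4 := integrable_EFinZ (- (2^-1 * alpha ^+ 4)) i4.
  have j12 := integrable_EFinD i1 j2; have j123 := integrable_EFinD j12 j3.
  rewrite (RintegralD measurableT j123 j4) (RintegralD measurableT j12 j3).
  rewrite (RintegralD measurableT i1 j2).
  rewrite (RintegralZl _ measurableT i2) (RintegralZl _ measurableT i3).
  by rewrite (RintegralZl _ measurableT i4) !mulNr.
rewrite -E; apply: eq_Rintegral => x _.
by rewrite /g /dg -!/(transported_potential _ _ _); field.
Qed.

Lemma Rintegral_Rp_itv (I J : R -> R) (T : R) :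
  (forall t, 0 <= t -> I t = J t) -> (forall t, 0 <= t -> T < t -> J t = 0) ->
  \int[leb]_(t in Rp) I t = \int[leb]_(t in `[0, T]) J t.
Proof.
move=> IJ J0; rewrite Rintegral_mkcond [RHS]Rintegral_mkcond.
apply: eq_Rintegral => t _; rewrite !patchE !mem_setE !in_itv/= andbT.
have [t0|//] := leP 0 t; have [tT|Tt] /= := leP t T; first exact: IJ.
by rewrite IJ// J0.
Qed.

(** The coefficients are abstract: the passage from the balance at each time to the integrated
    identity rests only on their regularity in time. *)
Lemma transported_integral_time_identity f B (G1 G2 G3 G4 : R -> R -> R) :
  smooth_Omega f -> supported B f ->
  ae_continuous_in_time G1 -> ae_continuous_in_time G2 ->
  ae_continuous_in_time G3 -> ae_continuous_in_time G4 ->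
  (forall t, 0 <= t ->
    \int[mu]_z (dx f (C z t) t * (W 0 (C z t) t ^+ 2 * W 3 (C z t) t)) =
    \int[leb]_x (G1 x t * dx f x t)
    - 2 * alpha ^+ 2 * \int[leb]_x (G2 x t * dx f x t)
    - alpha ^+ 4 * \int[leb]_x (G3 x t * dx f x t)
    - 2^-1 * alpha ^+ 4 * \int[leb]_x (G4 x t * dx (dx f) x t)) ->
  transported_integral f 0
  + \int[leb]_(t in Rp) \int[leb]_x
      (W 0 x t * helmholtz alpha (helmholtz alpha (dt f)) x t)
  + \int[leb]_(t in Rp) \int[leb]_x (G1 x t * dx f x t)
  - 2 * alpha ^+ 2 * \int[leb]_(t in Rp) \int[leb]_x (G2 x t * dx f x t)
  - alpha ^+ 4 * \int[leb]_(t in Rp) \int[leb]_x (G3 x t * dx f x t)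
  - 2^-1 * alpha ^+ 4 * \int[leb]_(t in Rp) \int[leb]_x (G4 x t * dx (dx f) x t) = 0.
Proof.
move=> sf Bf c1 c2 c3 c4 flux0.
have [sdt Bdt] := (smooth_Omega_dt sf, supported_dt Bf).
have [sdx Bdx] := (smooth_Omega_dx sf, supported_dx Bf).
have [sdxx Bdxx] := (smooth_Omega_dx sdx, supported_dx Bdx).
(* [T] is positive and beyond the support, so time integrals stop at [T] and the pairing vanishes
   there. *)
pose T : R := `|B| + 1.
have T0 : 0 < T by rewrite ltr_wpDl.
have TB t : T < t -> B < t.
  by apply: le_lt_trans; rewrite /T (le_trans (ler_norm B))// lerDl.
pose J (G g : R -> R -> R) (t : R) := \int[leb]_x (G x t * g x (Num.max t 0)).
have JtE (G g : R -> R -> R) (t : R) : 0 <= t -> J G g t = \int[leb]_x (G x t * g x t).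
  by move=> t0; rewrite /J max_l.
have JT (G g : R -> R -> R) (t : R) : supported B g -> 0 <= t -> T < t -> J G g t = 0.
  move=> Bg t0 Tt; rewrite /J (_ : (fun x => _) = cst 0); last first.
    by apply/funext => x; rewrite (Bg x)// ?mulr0// max_l//; right; exact: TB.
  by rewrite /Rintegral integral0.
have JE (G g : R -> R -> R) : supported B g ->
    \int[leb]_(t in Rp) \int[leb]_x (G x t * g x t) = \int[leb]_(t in `[0, T]) J G g t.
  move=> Bg; apply: Rintegral_Rp_itv; last by move=> t; exact: JT.
  by move=> t t0; rewrite JtE.
have e0 : \int[leb]_(t in Rp) \int[leb]_x
      (W 0 x t * helmholtz alpha (helmholtz alpha (dt f)) x t) =
    \int[leb]_(t in `[0, T]) transported_integral (dt f) t.
  apply: Rintegral_Rp_itv.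
  - by move=> t t0; rewrite (transported_integral_green sdt Bdt t0).
  - move=> t t0 Tt; rewrite /transported_integral (_ : (fun z => _) = cst 0); last first.
      by apply/funext => z; rewrite Bdt// max_l//; right; exact: TB.
    by rewrite /Rintegral integral0.
have flux t : 0 <= t -> \int[mu]_z (dx f (C z t) t * (W 0 (C z t) t ^+ 2 * W 3 (C z t) t)) =
    J G1 (dx f) t - 2 * alpha ^+ 2 * J G2 (dx f) t - alpha ^+ 4 * J G3 (dx f) t -
    2^-1 * alpha ^+ 4 * J G4 (dx (dx f)) t.
  by move=> t0; rewrite !(JtE _ _ _ t0); exact: flux0.
(* Stated over abstract reals, so that integrals are replaced without rewriting inside the large
   expression. *)
have replace_integrals (a k2 k3 k4 x0 x1 x2 x3 x4 y0 y1 y2 y3 y4 : R) :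
    x0 = y0 -> x1 = y1 -> x2 = y2 -> x3 = y3 -> x4 = y4 ->
    a + y0 + y1 - k2 * y2 - k3 * y3 - k4 * y4 = 0 ->
    a + x0 + x1 - k2 * x2 - k3 * x3 - k4 * x4 = 0.
  by move=> -> -> -> -> ->.
apply: (replace_integrals _ _ _ _ _ _ _ _ _ _ _ _ _ _ e0
  (JE G1 _ Bdx) (JE G2 _ Bdx) (JE G3 _ Bdx) (JE G4 _ Bdxx)).
have cJ0 := continuous_transported_integral sdt Bdt.
have cJ1 : continuous (J G1 (dx f)) := continuous_ae_continuous_in_time c1 sdx Bdx.
have cJ2 : continuous (J G2 (dx f)) := continuous_ae_continuous_in_time c2 sdx Bdx.
have cJ3 : continuous (J G3 (dx f)) := continuous_ae_continuous_in_time c3 sdx Bdx.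
have cJ4 : continuous (J G4 (dx (dx f))) := continuous_ae_continuous_in_time c4 sdxx Bdxx.
have dA (t : R) : 0 < t -> is_derive t 1 (transported_integral f)
    (transported_integral (dt f) t + J G1 (dx f) t - 2 * alpha ^+ 2 * J G2 (dx f) t -
     alpha ^+ 4 * J G3 (dx f) t - 2^-1 * alpha ^+ 4 * J G4 (dx (dx f)) t).
  move=> t0; apply: is_derive1_eq (is_derive_transported_integral sf Bf t0) _.
  rewrite (flux _ (ltW t0)).
  move: (transported_integral (dt f) t) (J G1 (dx f) t) (J G2 (dx f) t) (J G3 (dx f) t)
    (J G4 (dx (dx f)) t) => *; ring.
apply: (FTC_linear_combination T0 cJ0 cJ1 cJ2 cJ3 cJ4 _ dA).
- exact: continuous_transported_integral Bf.
- rewrite /transported_integral (_ : (fun z => _) = cst 0); first by rewrite /Rintegral integral0.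
  apply/funext => z; rewrite Bf// max_l ?ltW//; right.
  by rewrite (le_lt_trans (ler_norm B))// ltrDl.
Qed.

Lemma transported_integral_weak_identity f B : smooth_Omega f -> supported B f ->
  transported_integral f 0
  + \int[leb]_(t in Rp) \int[leb]_x
      (W 0 x t * helmholtz alpha (helmholtz alpha (dt f)) x t)
  + \int[leb]_(t in Rp) \int[leb]_x (W 0 x t ^+ 3 * W 3 x t * dx f x t)
  - 2 * alpha ^+ 2 * \int[leb]_(t in Rp) \int[leb]_x
      (W 0 x t ^+ 2 * W 2 x t * W 3 x t * dx f x t)
  - alpha ^+ 4 * \int[leb]_(t in Rp) \int[leb]_x
      (W 0 x t * W 1 x t * W 3 x t ^+ 2 * dx f x t)
  - 2^-1 * alpha ^+ 4 * \int[leb]_(t in Rp) \int[leb]_x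
      ((W 0 x t * W 3 x t) ^+ 2 * dx (dx f) x t) = 0.
Proof.
move=> sf Bf; have [c1 c2 c3 c4] := ae_continuous_in_time_fluxes.
apply: (transported_integral_time_identity sf Bf c1 c2 c3 c4) => t t0.
exact: (flux_identity (smooth_Omega_dx sf) (supported_dx Bf) t0).
Qed.

End transported_measure.

(** * Distributional derivatives of the potential *)

Section distributional.
Context {R : realType} (alpha : R).
Hypothesis alpha_gt0 : 0 < alpha.
Variable nu : {finite_measure set (measurableTypeR R) -> \bar R}.
Local Notation leb := (@lebesgue_measure R).

Lemma Ccinfty_support (psi : R -> R) : Ccinfty psi ->
  exists B : R, forall n x, B < `|x| -> derive1n n psi x = 0.
Proof.
move=> [_ /compact_bounded [D [_ DP]]].
exists (`|D| + 1) => n; elim: n => [|n IH] x Bx.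
  rewrite derive1n0; apply: contrapT => /eqP psix.
  have := DP (`|D| + 1); move: Bx; rewrite ltNge => /negP Bx H; apply: Bx; apply: H.
    by rewrite (le_lt_trans (ler_norm D))// ltrDl.
  exact: subset_closure.
rewrite derive1nS -(derive1_cst 0 x) !derive1E; apply: near_eq_derive.
have xn : `|y| @[y --> x] --> `|x| by apply: cvg_norm; exact: cvg_id.
near=> y; apply: IH.
by near: y; move/cvgr_gt : xn; exact.
Unshelve. all: by end_near. Qed.

Lemma locally_integrable_potential n : (n < 4)%N ->
  locally_integrable setT (potential alpha nu n).
Proof.
move=> n4; have mU := measurable_potential alpha_gt0 nu n4.
split => //; first exact: openT.
move=> A _ cA.
have : leb.-integrable A (EFin \o potential alpha nu n).
  apply: measurable_bounded_integrable.
  - exact: compact_measurable.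
  - exact: compact_finite_measure.
  - exact: measurable_funS mU.
  - exists (Kbound alpha * fine (nu setT)); split; first exact: num_real.
    move=> y By x _; apply: (le_trans _ (ltW By)); exact: potential_bound.
by case/integrableP.
Qed.

Lemma distr_derive_potential k : (k < 4)%N ->
  distr_derive k (potential alpha nu 0) (potential alpha nu k).
Proof.
move=> k4; split; [exact: locally_integrable_potential| exact: locally_integrable_potential|].
move=> psi psi_test; have [B B0] := Ccinfty_support psi_test.
have dpsi n (x : R) : is_derive x 1 (derive1n n psi) (derive1n n.+1 psi x).
  by rewrite derive1nS; apply: derivable_is_derive1; exact: psi_test.1.
have cpsi n : continuous (derive1n n psi).
  by move=> x; exact: is_derive1_continuous (dpsi n x).
(* The induction moves one derivative at a time; [j] counts those left on the test function, and a
   general [j] is what the next step requires. *)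
suff H m j : (m < 4)%N -> \int[leb]_x (potential alpha nu 0 x * derive1n (m + j) psi x) =
    (-1) ^+ m * \int[leb]_x (potential alpha nu m x * derive1n j psi x).
  by have := H k 0%N k4; rewrite addn0 derive1n0.
elim: m j => [|m IH] j m4; first by rewrite add0n expr0 mul1r.
have m3 : (m < 3)%N by lia.
rewrite addSnnS IH; last by lia.
rewrite (Rintegral_potential_by_parts alpha_gt0 nu m3 (dpsi j) (cpsi j.+1) (B := B)).
  by rewrite exprS mulN1r mulrN mulNr.
by move=> x Bx; split; exact: B0.
Qed.

End distributional.

(** * Reduction of the given flow to a globally defined transport *)

Theorem theorem2p3 (R : realType) (alpha : R) (alpha_gt0 : 0 < alpha)
  (mu : {finite_measure set (measurableTypeR R) -> \bar R})
  (mu_neq0 : mu setT != 0%E) (mu_le1 : (mu setT <= 1)%E)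
  (M : set R) (M_fin_or_R : finite_set M \/ M = setT)
  (supp_mu : msupp mu `<=` M)
  (c : R -> R -> R) (c_IM : IM M c)
  (c_ode : forall x t : R, M x -> 0 < t ->
     derive_ge0 (c x) t = velocity alpha mu M c x t)
  (c_init : forall x, M x -> c x 0 = x)
  (h : R -> {finite_measure set (measurableTypeR R) -> \bar R})
  (h_push : forall t : R, 0 <= t -> is_pushforward mu (h t) M (c^~ t)) :
  weak_solution alpha mu h.
Proof.
have [[_ mc c_C1] c_inj] := c_IM.
have mM : measurable (M : set (measurableTypeR R)).
  case: M_fin_or_R => [finM|->]; last exact: measurableT.
  apply: countable_measurable; first by move=> x; exact: measurable_set1.
  exact: finite_set_countable.
have muM : mu (~` M) = 0%E.
  apply/eqP; rewrite -measure_le0.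
  have [N [mN N0 MN]] := negligible_setC_msupp mu.
  rewrite -N0; apply: le_measure; rewrite ?inE//; first exact: measurableC.
  by apply: subset_trans MN; exact: subsetC.
have max_ge0 (s : R) : 0 <= Num.max s 0 by rewrite le_max lexx orbT.
(* Extension by 0 off [M] and by the initial value at negative times: [C] is measurable in [z] and
   continuous in [t] on the whole line. *)
pose C (z t : R) : R := ((c^~ (Num.max t 0)) \_ M) z.
have CE z t : M z -> 0 <= t -> C z t = c z t.
  by move=> Mz t0; rewrite /C patchE mem_set// max_l.
have CE' z t : ~ M z -> C z t = 0 by move=> Mz; rewrite /C patchE memNset.
pose nu t := h (Num.max t 0).
have mC t : measurable_fun setT (C^~ t : measurableTypeR R -> measurableTypeR R).
  by apply/(measurable_restrictT _ mM); exact: mc.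
have cC z : continuous (C z).
  have [Mz|nMz] := pselect (M z); last first.
    by rewrite (_ : C z = cst 0); [exact: cst_continuous|apply/funext => t; exact: CE'].
  rewrite (_ : C z = fun t => c z (Num.max t 0)).
    apply: continuous_within_Rp => t t0; apply: derivable_ge0_continuous => //.
    exact: (c_C1 z Mz).1.
  by apply/funext => t; rewrite /C patchE mem_set.
have nuE t (A : set (measurableTypeR R)) : measurable A -> nu t A = mu ((C^~ t) @^-1` A).
  move=> mA; rewrite /nu h_push//.
  have mCA : measurable ((C^~ t) @^-1` A : set (measurableTypeR R)).
    by rewrite -[X in measurable X]setTI; exact: mC.
  have -> : (c^~ (Num.max t 0)) @^-1` A `&` M = (C^~ t) @^-1` A `&` M.
    apply/seteqP; split => z [/= Az Mz]; split => //; move: Az;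
      by rewrite /C patchE mem_set.
  (* Off [M] the preimage under [C] may contain extra labels, but these form a [mu]-null set. *)
  rewrite (measureDI mu mCA mM) [X in (X + _)%E](_ : _ = 0%E) ?add0e//.
  apply/eqP; rewrite -measure_le0 -muM; apply: le_measure; rewrite ?inE.
  - exact: measurableD.
  - exact: measurableC.
  - by move=> z [].
have mKC n z t : (n < 4)%N ->
    measurable_fun setT (fun y : measurableTypeR R => Kn alpha n (C z t - C y t)).
  by move=> n4; have := measurableT_comp (measurable_Kn_subl alpha (C z t) n4) (mC t).
pose W := transported_potential alpha nu.
have HE z t : M z -> 0 <= t -> H alpha mu M c z t = W 0%N (C z t) t.
  move=> Mz t0.
  rewrite /W (potential_transported alpha_gt0 mC nuE)// /H.
  rewrite -(@Rintegral_carrier _ mu M mM muM _ (Kbound alpha)).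
  - apply: eq_Rintegral => y; rewrite inE => My; by rewrite Kn0E !CE.
  - exact: mKC.
  - by move=> y; exact: Kn_bound.
have VE z t : M z -> 0 < t ->
    velocity alpha mu M c z t = W 0%N (C z t) t ^+ 2 * W 3 (C z t) t.
  move=> Mz t0; rewrite /velocity HE// ?ltW//; congr (_ * _).
  rewrite /W (potential_transported alpha_gt0 mC nuE)//.
  rewrite -(@Rintegral_carrier _ mu M mM muM _ (Kbound alpha)).
  - rewrite Rintegral_mkcond [RHS]Rintegral_mkcond; apply: eq_Rintegral => y _.
    (* The label [y = z], excluded on the left, contributes 0 on the right because [Kn 3 0 = 0]. *)
    have [yz|yz] := eqVneq y z.
      rewrite yz (patchE _ M) (mem_set Mz) subrr Kn3_0.
      by rewrite patchE memNset//= => -[].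
    have [My|nMy] := pselect (M y); last first.
      by rewrite !patchE !memNset//= => -[].
    rewrite !patchE !mem_set//=; last by split => //; exact/eqP.
    rewrite !CE ?ltW//; apply: derive1n3_K => //; rewrite subr_eq0.
    have t0' := ltW t0.
    (* Strict monotonicity keeps distinct labels at distinct positions, so K''' is evaluated off the
       origin, where it is classical. *)
    case: (ltgtP y z) yz => // yz _; have := c_inj t t0' _ _ _ _ yz => ccz.
      by rewrite gt_eqF// ccz.
    by rewrite lt_eqF// ccz.
  - exact: mKC.
  - by move=> y; exact: Kn_bound.
have dC (z t : R) : M z -> 0 < t ->
    is_derive t 1 (C z) (W 0%N (C z t) t ^+ 2 * W 3 (C z t) t).
  move=> Mz t0; rewrite -VE// -c_ode//.
  apply: (@near_eq_is_derive _ _ _ (c z)).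
    near=> s; rewrite CE//; apply: ltW; near: s; exact: lt_nbhsr.
  by apply: derivable_ge0_is_derive => //; apply: (c_C1 z Mz).1; exact: ltW.
have uE t : Kconv alpha (h t) = potential alpha (h t) 0.
  by apply/funext => x; rewrite /Kconv /potential Kn0E.
exists (fun x t => potential alpha (h t) 1 x), (fun x t => potential alpha (h t) 2 x),
  (fun x t => potential alpha (h t) 3 x); split.
  by move=> t t0; rewrite uE; split; exact: distr_derive_potential.
move=> phi phi_test; have [B suppB] := Ccinfty_Omega_supported phi_test.
have := transported_integral_weak_identity alpha_gt0 mC cC nuE mM muM dC phi_test.1 suppB.
have replace_integrals (k2 k3 k4 a x0 x1 x2 x3 x4 b y0 y1 y2 y3 y4 : R) :
    a = b -> x0 = y0 -> x1 = y1 -> x2 = y2 -> x3 = y3 -> x4 = y4 ->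
    b + y0 + y1 - k2 * y2 - k3 * y3 - k4 * y4 = 0 ->
    a + x0 + x1 - k2 * x2 - k3 * x3 - k4 * x4 = 0.
  by move=> -> -> -> -> -> ->.
have WE n x t : t \in (Rp : set R) -> transported_potential alpha nu n x t = potential alpha (h t) n x.
  by rewrite inE/= in_itv/= andbT => t0; rewrite /transported_potential /nu max_l.
apply: replace_integrals.
(* Restricting to [M] is what allows the initial condition: off [M], [C z 0] is 0 and not [z]. *)
- have [D phiD] := supported_bounded phi_test.1 suppB.
  rewrite (transported_integral_carrier mC mM muM _ phi_test.1 suppB).
  rewrite -(@Rintegral_carrier _ mu M mM muM _ D).
  + apply: eq_Rintegral => z; rewrite inE => Mz.
    by rewrite CE// c_init// max_l.
  + apply: measurable_fun_continuous => x.
    exact: is_derive1_continuous (smooth_Omega_is_derive x phi_test.1 (lexx _)).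
  + by move=> x; exact: phiD.
- by apply: eq_Rintegral => t Rt; apply: eq_Rintegral => x _; rewrite uE WE.
- by apply: eq_Rintegral => t Rt; apply: eq_Rintegral => x _; rewrite uE !WE.
- by apply: eq_Rintegral => t Rt; apply: eq_Rintegral => x _; rewrite uE !WE.
- by apply: eq_Rintegral => t Rt; apply: eq_Rintegral => x _; rewrite uE !WE.
- by apply: eq_Rintegral => t Rt; apply: eq_Rintegral => x _; rewrite uE !WE.
Unshelve. all: by end_near. Qed.
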